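(* Let $S$ be a conservative system node with input/state/output spaces $(\mathcal U,\mathcal X,\mathcal Y)$ and transfer function $\varphi$. Then the bilateral input map $\mathfrak B_{bil}:\mathcal H_s\to\mathcal X$ of $S$ intertwines the model $S_s$ (built from $\varphi$) isometrically with $S$. Additionally, $S$ is simple if and only if $\mathfrak B_{bil}$ is unitary.
   Context: All Hilbert spaces are complex; inner products are linear in the first slot; $\begin{bmatrix}\mathcal X\\ \mathcal U\end{bmatrix}$ is the orthogonal direct sum; $1$ denotes an identity operator; $\mathbb C^+=\{\operatorname{Re}\lambda>0\}$. $\mathcal U,\mathcal Y$ are separable. System nodes: a system node with input/state/output Hilbert spaces $(\mathcal U,\mathcal X,\mathcal Y)$ is a linear operator $S=\begin{bmatrix}A\&B\\ C\&D\end{bmatrix}:\begin{bmatrix}\mathcal X\\ \mathcal U\end{bmatrix}\supset\mathrm{dom}(S)\to\begin{bmatrix}\mathcal X\\ \mathcal Y\end{bmatrix}$ (rows $A\&B$, $C\&D$ defined on $\mathrm{dom}(S)$) such that $S$ and $A\&B$ are closed; the main operator $A$, $Ax=A\&B\begin{bmatrix}x\\ 0\end{bmatrix}$ with $\mathrm{dom}(A)=\{x:\begin{bmatrix}x\\ 0\end{bmatrix}\in\mathrm{dom}(S)\}$, generates a $C_0$-semigroup on $\mathcal X$; and for every $u\in\mathcal U$ there is $x$ with $\begin{bmatrix}x\\ u\end{bmatrix}\in\mathrm{dom}(S)$. For fixed $\beta\in\mathrm{res}(A)$, $\mathcal X_{-1}$ is the completion of $\mathcal X$ in the norm $\|(\beta-A)^{-1}x\|$,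 $A_{-1}\in\mathcal L(\mathcal X;\mathcal X_{-1})$ is the continuous extension of $A$. The control operator is the unique $B\in\mathcal L(\mathcal U;\mathcal X_{-1})$ with $A\&B=\begin{bmatrix}A_{-1}&B\end{bmatrix}|_{\mathrm{dom}(S)}$; the observation operator is $C:\mathrm{dom}(A)\to\mathcal Y$, $Cx=C\&D\begin{bmatrix}x\\ 0\end{bmatrix}$; the transfer function is $\lambda\mapsto C\&D\begin{bmatrix}(\lambda-A_{-1})^{-1}B\\ 1\end{bmatrix}$. The adjoint $S^*$ is a system node with main operator $A^*$, control operator $C^*$, observation operator $B^*$; $A^d_{-1}$ is the extension of $A^*$ to $\mathcal X$ with values in the extrapolation space of $A^*$, and $(\overline\lambda-A^d_{-1})^{-1}C^*=(C(\lambda-A)^{-1})^*$. $S$ is passive if $2\operatorname{Re}\langle z,x\rangle\le\|u\|^2-\|y\|^2$ for all $\begin{bmatrix}x\\ u\end{bmatrix}\in\mathrm{dom}(S)$, $\begin{bmatrix}z\\ y\end{bmatrix}=S\begin{bmatrix}x\\ u\end{bmatrix}$; energy preserving if equality always holds; conservative if both $S$ and $S^*$ are energy preserving. For passive $S$, $\mathbb C^+\subset\mathrm{res}(A)$ and the transfer function, restricted to $\mathbb C^+$, is a Schur function (analytic, contraction-valued). A passive $S$ is simple if the closed linear span of all $(\lambda-A^d_{-1})^{-1}C^*\gamma+(\lambda_*-A_{-1})^{-1}B\nu$, $\lambda,\lambda_*\in\mathbb C^+$, $\gamma\in\mathcal Y$, $\nu\in\mathcal U$, is $\mathcal X$. Spaces: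 $\widetilde\varphi(\mu):=\varphi(\overline\mu)^*$. $\mathcal H_s$ is the RKHS of functions $(\mu,\mu_* )\mapsto\begin{bmatrix}x_1(\mu)\\ x_2(\mu_* )\end{bmatrix}\in\begin{bmatrix}\mathcal Y\\ \mathcal U\end{bmatrix}$ on $\mathbb C^+\times\mathbb C^+$ with (positive) reproducing kernel $$K_s(\mu,\mu_*,\lambda,\lambda_* )=\begin{bmatrix}\frac{1-\varphi(\mu)\varphi(\lambda)^*}{\mu+\overline\lambda}&\frac{\varphi(\overline{\lambda_*})-\varphi(\mu)}{\mu-\overline{\lambda_*}}\\ \frac{\widetilde\varphi(\overline\lambda)-\widetilde\varphi(\mu_* )}{\mu_*-\overline\lambda}&\frac{1-\widetilde\varphi(\mu_* )\widetilde\varphi(\lambda_* )^*}{\mu_*+\overline{\lambda_*}}\end{bmatrix}$$ (removable singularities removed), and $e_s(\lambda,\lambda_* )$ is point evaluation, so $e_s(\lambda,\lambda_* )^*h=K_s(\cdot,\cdot,\lambda,\lambda_* )h$. The bilateral input map $\mathfrak B_{bil}$ of $S$ is the unique bounded (in fact contractive) operator $\mathcal H_s\to\mathcal X$ with $\mathfrak B_{bil}e_s(\lambda,\lambda_* )^*\begin{bmatrix}\gamma\\ \nu\end{bmatrix}=(\overline\lambda-A^d_{-1})^{-1}C^*\gamma+(\overline{\lambda_*}-A_{-1})^{-1}B\nu$ for all $\lambda,\lambda_*\in\mathbb C^+$, $\gamma\in\mathcal Y$, $\nu\in\mathcal U$. The model $S_s:\begin{bmatrix}\mathcal H_s\\ \mathcal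 U\end{bmatrix}\supset\mathrm{dom}(S_s)\to\begin{bmatrix}\mathcal H_s\\ \mathcal Y\end{bmatrix}$ is the (well-defined) extension by linearity and operator closure of $$\begin{bmatrix}e_s(\lambda,\lambda_* )^*\begin{bmatrix}\gamma\\ \nu\end{bmatrix}\\ \widetilde\varphi(\overline\lambda)\gamma+\nu\end{bmatrix}\mapsto\begin{bmatrix}e_s(\lambda,\lambda_* )^*\begin{bmatrix}-\overline\lambda\gamma\\ \overline{\lambda_*}\nu\end{bmatrix}\\ \gamma+\varphi(\overline{\lambda_*})\nu\end{bmatrix},\quad\lambda,\lambda_*\in\mathbb C^+,\gamma\in\mathcal Y,\nu\in\mathcal U.$$ Intertwinement: for system nodes $S_0,S_1$ with state spaces $\mathcal X_0,\mathcal X_1$ and the same input and output spaces, $E\in\mathcal L(\mathcal X_0;\mathcal X_1)$ intertwines $S_0$ with $S_1$ if $\begin{bmatrix}E&0\\ 0&1\end{bmatrix}\mathrm{dom}(S_0)\subset\mathrm{dom}(S_1)$ and $\begin{bmatrix}E&0\\ 0&1\end{bmatrix}S_0=S_1\begin{bmatrix}E&0\\ 0&1\end{bmatrix}\Big|_{\mathrm{dom}(S_0)}$; isometrically means $E$ is isometric. *)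

(* Defs.v *)
From HB Require Import structures.
From mathcomp Require Import all_boot all_order all_algebra.
From mathcomp Require Import complex.
From mathcomp Require Import boolp classical_sets functions cardinality reals.
From mathcomp Require Import topology normedtype derive.

Set Implicit Arguments.
Unset Strict Implicit.
Unset Printing Implicit Defensive.

Import Order.TTheory GRing.Theory Num.Theory Num.Def.
Import numFieldNormedType.Exports.

Local Open Scope classical_set_scope.
Local Open Scope ring_scope.

(* Forms in {dot _ for _} are linear in the first slot and conjugate-linear
   in the second one. *)
HB.mixin Record Lmodule_isInnerProduct (R : realType) H
    of GRing.Lmodule R[i] H := {
  inner : {dot H for @conjC R[i]}
}.

#[short(type="innerProductType")]
HB.structure Definition InnerProduct (R : realType) :=
  { H of GRing.Lmodule R[i] H & Lmodule_isInnerProduct R H }.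

Notation "''[' x , y ]" := (inner x y) : ring_scope.

HB.mixin Record InnerProduct_isHilbert (R : realType) H
    of CompleteNormedModule R[i] H & InnerProduct R H := {
  inner_norm : forall x : H, inner x x = `|x| ^+ 2
}.

#[short(type="hilbertType")]
HB.structure Definition Hilbert (R : realType) :=
  { H of CompleteNormedModule R[i] H & InnerProduct R H
       & InnerProduct_isHilbert R H }.

(* The orthogonal direct sum of two Hilbert spaces V and W is V * W with the
   inner product below.  The norm that the library puts on V * W is the max
   norm, which is equivalent to the Hilbert norm: only the topology of V * W
   is used in the sequel. *)
Section DirectSum.
Variables (R : realType) (V W : innerProductType R).

Definition sum_inner (p q : V * W) : R[i] := '[p.1, q.1] + '[p.2, q.2].

Lemma sum_inner_l q : scalar (sum_inner^~ q).
Proof.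
move=> a x y; rewrite /sum_inner /= !linearPl /=.
by rewrite mulrDr addrACA.
Qed.

Lemma sum_inner_r p : GRing.linear_for (@conjC R[i] \; *%R) (sum_inner p).
Proof.
move=> a x y; rewrite /sum_inner /= !linearPr /=.
by rewrite mulrDr addrACA.
Qed.

HB.instance Definition _ :=
  @bilinear_isBilinear.Build R[i] (V * W)%type (V * W)%type R[i] *%R
    (@conjC R[i] \; *%R) sum_inner (sum_inner_l, sum_inner_r).

Lemma sum_inner_sym p q :
  sum_inner p q = (-1) ^+ false * conjC (sum_inner q p).
Proof.
rewrite expr0 mul1r /sum_inner rmorphD /=; congr (_ + _).
- by rewrite (@hermitian_subproof _ _ _ _ inner) expr0 mul1r.
- by rewrite (@hermitian_subproof _ _ _ _ inner) expr0 mul1r.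
Qed.

HB.instance Definition _ :=
  @isHermitianSesquilinear.Build R[i] (V * W)%type false (@conjC R[i])
    sum_inner sum_inner_sym.

Lemma sum_inner_gt0 p : p != 0 -> 0 < sum_inner p p.
Proof.
have ip_gt0 (H : innerProductType R) (x : H) : x != 0 -> 0 < '[x, x].
  exact: neq0_dnorm_gt0.
have ip_ge0 (H : innerProductType R) (x : H) : 0 <= '[x, x].
  by have [->|x0] := eqVneq x 0; [rewrite linear0l | exact/ltW/ip_gt0].
case: p => x y; rewrite /sum_inner /= => xy0.
have [x0|x0] := eqVneq x 0; last by rewrite ltr_pwDl ?ip_gt0.
rewrite ltr_wpDl ?ip_gt0//; apply: contraNneq xy0 => y0.
by rewrite x0 y0.
Qed.

HB.instance Definition _ :=
  @isDotProduct.Build R[i] (V * W)%type sum_inner sum_inner_gt0.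

HB.instance Definition _ :=
  @Lmodule_isInnerProduct.Build R (V * W)%type sum_inner.

End DirectSum.

(* Unbounded operators V -> W are represented by their graphs. *)
Section Graphs.
Variables (R : realType) (V W : normedModType R[i]).
Implicit Type G : set (V * W).

Definition linear_operator G :=
  [/\ G 0,
      forall (a : R[i]) p q, G p -> G q -> G (a *: p + q) &
      forall v w w', G (v, w) -> G (v, w') -> w = w'].

Definition dom G : set V := [set v | exists w, G (v, w)].

(* the value at v of the operator with graph G; 0 outside the domain *)
Definition gapply G (v : V) : W := xget 0 [set w | G (v, w)].

Definition graph_of (f : V -> W) : set (V * W) := [set p | p.2 = f p.1].

Definition graph_inv G : set (W * V) := [set p | G (p.2, p.1)].

Definition bounded_operator (f : V -> W) := linear f /\ continuous f.

End Graphs.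

Definition lspan (R : realType) (V : lmodType R[i]) (A : set V) : set V :=
  [set x | exists n (a : 'I_n -> R[i]) (v : 'I_n -> V),
    (forall k, A (v k)) /\ x = \sum_(k < n) a k *: v k].

Definition separable (T : topologicalType) :=
  exists2 D : set T, countable D & dense D.

Section Adjoint.
Variables (R : realType) (V W : innerProductType R).

Definition graph_adjoint (G : set (V * W)) : set (W * V) :=
  [set p | forall q, G q -> '[q.2, p.1] = '[q.1, p.2]].

End Adjoint.

Definition adjoint (R : realType) (V W : hilbertType R) (f : V -> W) : W -> V :=
  gapply (graph_adjoint (graph_of f)).

Section Isometries.
Variables (R : realType) (V W : hilbertType R).
Implicit Type E : V -> W.

Definition isometric E := forall x, `|E x| = `|x|.

Definition unitary E :=
  (forall x y, '[E x, E y] = '[x, y]) /\ (forall w, exists x, E x = w).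

End Isometries.

Section Resolvent.
Variables (R : realType) (X : hilbertType R).
Implicit Types (A : set (X * X)) (l : R[i]).

Definition shift_graph l A : set (X * X) :=
  [set (p.1, l *: p.1 - p.2) | p in A].

Definition resolvent_set A : set R[i] :=
  [set l | exists2 Q : X -> X, bounded_operator Q &
    graph_inv (shift_graph l A) = graph_of Q].

Definition resolvent A l : X -> X := gapply (graph_inv (shift_graph l A)).

End Resolvent.

Section Semigroups.
Variables (R : realType) (X : hilbertType R).
Implicit Type T : R -> X -> X.

Definition C0_semigroup T :=
  [/\ forall t, 0 <= t -> bounded_operator (T t),
      forall x, T 0 x = x,
      forall s t, 0 <= s -> 0 <= t -> forall x, T (s + t) x = T s (T t x) &
      forall x, T t x @[t --> 0^'+] --> x].

Definition generator T : set (X * X) :=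
  [set p | ((h%:C)%C^-1 *: (T h p.1 - p.1)) @[h --> 0^'+] --> p.2].

Definition generates_C0_semigroup (A : set (X * X)) :=
  exists2 T, C0_semigroup T & A = generator T.

End Semigroups.

(* A space X_{-1}, together with the embedding of X and the extension A_{-1}.
   The completion of X for the norm |(beta - A)^{-1} x| is only determined up
   to isometric isomorphism: it is any complete space containing, through
   extra_emb, a dense isometric copy of X with that norm. *)
Record extrapolation (R : realType) (X : hilbertType R) (A : set (X * X)) :=
  Extrapolation {
    extra_point : R[i];
    extra_pointP : resolvent_set A extra_point;
    extra_space :> completeNormedModType R[i];
    extra_emb : {linear X -> extra_space};
    extra_emb_norm : forall x,
      `|extra_emb x| = `|resolvent A extra_point x|;
    extra_emb_dense : dense (range extra_emb);
    extra_op : {linear X -> extra_space};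
    extra_op_continuous : continuous extra_op;
    extra_opE : forall x z, A (x, z) -> extra_op x = extra_emb z
  }.

(* (l - A_{-1})^{-1} w *)
Definition extra_resolvent (R : realType) (X : hilbertType R)
    (A : set (X * X)) (Xm1 : extrapolation A) (l : R[i]) (w : Xm1) : X :=
  gapply (graph_inv
    (graph_of (fun x => l *: extra_emb Xm1 x - extra_op Xm1 x))) w.

(* Graphs of system nodes: a member ((x, u), (z, y)) means that (x, u) is in
   dom S and S (x, u) = (z, y). *)
Section SystemNodes.
Variables (R : realType) (U X Y : hilbertType R).
Implicit Type S : set ((X * U) * (X * Y)).

Definition AandB S : set ((X * U) * X) :=
  [set p | exists y, S (p.1, (p.2, y))].

Definition CandD S : set ((X * U) * Y) :=
  [set p | exists z, S (p.1, (z, p.2))].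

Definition main_operator S : set (X * X) :=
  [set p | AandB S ((p.1, 0), p.2)].

Definition system_node S :=
  [/\ linear_operator S,
      closed S,
      closed (AandB S),
      generates_C0_semigroup (main_operator S) &
      forall u, exists x, dom S (x, u)].

Definition energy_preserving S := forall x u z y, S ((x, u), (z, y)) ->
  2 * 'Re '[z, x] = `|u| ^+ 2 - `|y| ^+ 2.

(* For S itself A is main_operator S; for the dual node, A is the adjoint
   of the main operator. *)
Definition control_operator S (A : set (X * X)) (Xm1 : extrapolation A)
    (B : U -> Xm1) :=
  bounded_operator B /\
  forall x u z, AandB S ((x, u), z) ->
    extra_emb Xm1 z = extra_op Xm1 x + B u.

Definition transfer_function S (A : set (X * X)) (Xm1 : extrapolation A)
    (B : U -> Xm1) (l : R[i]) (u : U) : Y :=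
  gapply (CandD S) (extra_resolvent l (B u), u).

End SystemNodes.

Definition conservative (R : realType) (U X Y : hilbertType R)
    (S : set ((X * U) * (X * Y))) :=
  energy_preserving S /\ energy_preserving (graph_adjoint S).

Definition simple (R : realType) (U X Y : hilbertType R) (A Ad : set (X * X))
    (Xm1 : extrapolation A) (B : U -> Xm1)
    (Xdm1 : extrapolation Ad) (Cstar : Y -> Xdm1) :=
  closure (lspan [set x : X | exists (l ls : R[i]) (c : Y) (v : U),
    [/\ 0 < 'Re l, 0 < 'Re ls &
        x = extra_resolvent l (Cstar c) + extra_resolvent ls (B v)]]) = setT.

Definition cplus (R : realType) := {z : R[i] | 0 < 'Re z}.
Coercion cplus_val (R : realType) (z : cplus R) : R[i] := sval z.

(* A Hilbert space of functions T -> W with reproducing kernel K; rk_adj t is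
   the adjoint of the evaluation at t. *)
Record rkhs (R : realType) (T : Type) (W : innerProductType R)
    (K : T -> T -> W -> W) := Rkhs {
  rk_space :> hilbertType R;
  rk_eval : rk_space -> T -> W;
  rk_eval_linear : forall t, linear (rk_eval^~ t);
  rk_eval_inj : injective rk_eval;
  rk_adj : T -> W -> rk_space;
  rk_adjP : forall f t w, '[rk_eval f t, w] = '[f, rk_adj t w];
  rk_adjE : forall s t w, rk_eval (rk_adj t w) s = K s t w
}.

Section Model.
Variables (R : realType) (U Y : hilbertType R).
Implicit Type phi : R[i] -> U -> Y.

Definition tilde phi (m : R[i]) : Y -> U := adjoint (phi m^*).

(* (f a - f m) / (m - a), with the removable singularity at m = a removed *)
Definition diff_quotient (V : normedModType R[i]) (f : R[i] -> V)
    (m a : R[i]) : V :=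
  if m == a then - derive1 f a else (m - a)^-1 *: (f a - f m).

Definition Ks phi (s t : cplus R * cplus R) (w : Y * U) : Y * U :=
  let m : R[i] := s.1 in let ms : R[i] := s.2 in
  let l : R[i] := t.1 in let ls : R[i] := t.2 in
  let c := w.1 in let v := w.2 in
  ((m + l^*)^-1 *: (c - phi m (adjoint (phi l) c))
     + diff_quotient (phi^~ v) m ls^*,
   diff_quotient ((tilde phi)^~ c) ms l^*
     + (ms + ls^*)^-1 *: (v - tilde phi ms (adjoint (tilde phi ls) v))).

Definition model phi (Hs : rkhs (Ks phi)) : set ((Hs * U) * (Hs * Y)) :=
  closure (lspan [set p | exists (l ls : cplus R) (c : Y) (v : U),
    p = ((rk_adj Hs (l, ls) (c, v), tilde phi (l : R[i])^* c + v),
         (rk_adj Hs (l, ls) (- (l : R[i])^* *: c, (ls : R[i])^* *: v),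
          c + phi (ls : R[i])^* v))]).

End Model.
Arguments model {R U Y phi} Hs.

(* The defining equation, which determines a bounded map uniquely since the
   elements rk_adj Hs t w span a dense subspace of Hs. *)
Definition bilateral_input_map (R : realType) (U X Y : hilbertType R)
    (A Ad : set (X * X)) (Xm1 : extrapolation A) (B : U -> Xm1)
    (Xdm1 : extrapolation Ad) (Cstar : Y -> Xdm1)
    (phi : R[i] -> U -> Y) (Hs : rkhs (Ks phi)) (Bbil : Hs -> X) :=
  bounded_operator Bbil /\
  forall (l ls : cplus R) (c : Y) (v : U),
    Bbil (rk_adj Hs (l, ls) (c, v)) =
      extra_resolvent (l : R[i])^* (Cstar c)
      + extra_resolvent (ls : R[i])^* (B v).

Definition intertwines (R : realType) (U Y X0 X1 : hilbertType R)
    (S0 : set ((X0 * U) * (X0 * Y))) (S1 : set ((X1 * U) * (X1 * Y)))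
    (E : X0 -> X1) :=
  [/\ bounded_operator E,
      forall x u, dom S0 (x, u) -> dom S1 (E x, u) &
      (* equality of the graphs of the two compositions *)
      [set p | exists2 q, S0 (p.1, q) & p.2 = (E q.1, q.2)] =
      [set p | dom S0 p.1 /\ S1 ((E p.1.1, p.1.2), p.2)]].

(* Main.v *)
(* The polarized energy balance shows that [S] maps [(x, u)] to [(z, y)] iff [S^*]
   maps [(x, y)] to [(- z, u)].  Hence [S] contains the images under the bilateral
   input map of the pairs that generate the model, and the energy balance between
   two of these says that their state components have the Gram matrix prescribed
   by the kernel [K_s] (the diagonal, where a derivative appears, is reached by
   continuity of the resolvents).  So the map is isometric and, [S] being closed,
   intertwines; its range is closed and equals the whole space iff [S] is simple.

   The resolvents exist on the right half-plane because [A] is dissipative and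
   generates a semigroup [T]: [T] is contractive, and a vector [q] orthogonal to
   the range of [l - A] would make [|<T t x, q>|] grow at least linearly for [x]
   in [dom A], unless [<x, q> = 0].  The solutions of the adjoint equation come
   from the Riesz theorem. *)

From HB Require Import structures.
Require Import Defs.
From mathcomp Require Import all_boot all_order all_algebra.
From mathcomp Require Import complex.
From mathcomp Require Import boolp classical_sets functions cardinality reals.
From mathcomp Require Import topology normedtype derive.
From mathcomp Require Import prodnormedzmodule ring lra.

Set Implicit Arguments.
Unset Strict Implicit.
Unset Printing Implicit Defensive.

Import Order.TTheory GRing.Theory Num.Theory.
Import numFieldNormedType.Exports.

Local Open Scope classical_set_scope.
Local Open Scope ring_scope.

(** The adjoint is not assumed to be a system node. The equations for [S^*] at [l] are solved by
    duality from those for [S] at [l^*], and [A^*] is shown to be the main operator of [S^*]; only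
    then can the extrapolation space of [A^*] be used for the output vectors.

    A one-sided growth estimate yields contractivity only if norms of orbits cannot jump up from the
    left, while a C0-semigroup is by definition continuous only from the right at 0, without a
    uniform bound there. A weak compactness argument, in the form of nested convex sets, fills this
    gap.

    On the diagonal of the kernel the energy balance gives scalar identities, whereas the derivative
    in [diff_quotient] is a limit in norm. The gap is closed by testing the error of the difference
    quotient against itself.

    Isometry passes from the kernel functions to all of [Hs] without approximation: [E^* E] is seen
    to be the identity by pairing with kernel functions. *)

Lemma invr_nat_lt (R : realType) (e : R) : 0 < e ->
  exists k, forall n, (k <= n)%N -> n.+1%:R^-1 < e.
Proof.
move=> e0; have [k] := @ltr_add_invr _ 0 e e0; rewrite add0r => kP.
exists k => n kn.
by apply: le_lt_trans kP; rewrite lef_pV2 ?posrE ?ltr0n// ler_nat.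
Qed.

(** * Real-valued norms *)

Section RealNorm.
Variables (R : realType).
Implicit Types (V W : normedModType R[i]).

(** The norm takes values in [R[i]], which is only partially ordered; its real part is the same
    number in [R], where real arithmetic applies. *)
Definition rnorm V (x : V) : R := complex.Re `|x|.

Lemma normE V (x : V) : `|x| = (rnorm x)%:C%C.
Proof. by rewrite /rnorm RRe_real ?normr_real. Qed.

Lemma rnorm_ge0 V (x : V) : 0 <= rnorm x.
Proof. by rewrite -lecR -normE normr_ge0. Qed.

Lemma rnorm0 V : rnorm (0 : V) = 0.
Proof. by rewrite /rnorm normr0. Qed.

Lemma rnorm_eq0 V (x : V) : rnorm x = 0 -> x = 0.
Proof. by move=> x0; apply/normr0_eq0; rewrite normE x0. Qed.

Lemma rnormD V (x y : V) : rnorm (x + y) <= rnorm x + rnorm y.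
Proof. by rewrite -lecR rmorphD /= -!normE ler_normD. Qed.

Lemma rnormN V (x : V) : rnorm (- x) = rnorm x.
Proof. by rewrite /rnorm normrN. Qed.

Lemma rnormBC V (x y : V) : rnorm (x - y) = rnorm (y - x).
Proof. by rewrite /rnorm distrC. Qed.

Lemma rnormB V (x y z : V) : rnorm (x - z) <= rnorm (x - y) + rnorm (y - z).
Proof. by rewrite (le_trans _ (rnormD _ _))// addrA subrK. Qed.

Definition cnorm (a : R[i]) : R := complex.Re `|a|.

Lemma cnormE (a : R[i]) : `|a| = (cnorm a)%:C%C.
Proof. by rewrite /cnorm RRe_real ?normr_real. Qed.

Lemma cnorm_ge0 (a : R[i]) : 0 <= cnorm a.
Proof. by rewrite -lecR -cnormE normr_ge0. Qed.

Lemma cnorm_eq0 (a : R[i]) : cnorm a = 0 -> a = 0.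
Proof. by move=> a0; apply/normr0_eq0; rewrite cnormE a0. Qed.

Lemma cnormM (a b : R[i]) : cnorm (a * b) = cnorm a * cnorm b.
Proof. by apply: complexI; rewrite rmorphM /= -!cnormE normrM. Qed.

Lemma cnormD (a b : R[i]) : cnorm (a + b) <= cnorm a + cnorm b.
Proof. by rewrite -lecR rmorphD /= -!cnormE ler_normD. Qed.

Lemma cnormN (a : R[i]) : cnorm (- a) = cnorm a.
Proof. by rewrite /cnorm normrN. Qed.

Lemma cnormJ (a : R[i]) : cnorm a^* = cnorm a.
Proof. by rewrite /cnorm norm_conjC. Qed.

Lemma cnormC (r : R) : cnorm r%:C%C = `|r|.
Proof. by rewrite /cnorm normc_def /= expr0n /= addr0 sqrtr_sqr. Qed.

Lemma Re_le_cnorm (a : R[i]) : `|complex.Re a| <= cnorm a.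
Proof. by rewrite -lecR -cnormE normc_ge_Re. Qed.

Lemma conjCr (r : R) : (r%:C%C)^* = r%:C%C :> R[i].
Proof. exact: conjc_real. Qed.

Lemma mulCJ (a : R[i]) : a * a^* = (cnorm a ^+ 2)%:C%C.
Proof. by rewrite -normCK cnormE -rmorphXn. Qed.

Lemma rnormZ V (a : R[i]) (x : V) : rnorm (a *: x) = cnorm a * rnorm x.
Proof. by apply: complexI; rewrite rmorphM /= -!normE -cnormE normrZ. Qed.

Lemma rnormZr V (r : R) (x : V) : rnorm (r%:C%C *: x) = `|r| * rnorm x.
Proof. by rewrite rnormZ cnormC. Qed.

Lemma closure_rnormP V (A : set V) p :
  closure A p <-> forall e : R, 0 < e -> exists2 q, A q & rnorm (q - p) < e.
Proof.
split=> [Ap e e0|Ap B].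
  have [|q [Aq]] := Ap (ball p e%:C%C).
    by apply: nbhsx_ballx; rewrite ltcR.
  rewrite -ball_normE /= normE ltcR => pq; exists q => //.
  by rewrite rnormBC.
rewrite -filter_from_ballE => -[e /= e0 eB].
have e_real : e = (complex.Re e)%:C%C by rewrite RRe_real// gtr0_real.
have [|q Aq qp] := Ap (complex.Re e); first by rewrite -ltcR -e_real.
exists q; split=> //; apply: eB.
by rewrite -ball_normE /= normE e_real ltcR rnormBC.
Qed.

Lemma closed_rnorm V (A : set V) p : closed A ->
  (forall e : R, 0 < e -> exists2 q, A q & rnorm (q - p) < e) -> A p.
Proof. by move=> Acl /closure_rnormP; apply: Acl. Qed.

Lemma rnorm_closed V (C : set V) :
  (forall x, (forall e : R, 0 < e -> exists2 y, C y & rnorm (y - x) < e) ->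
    C x) -> closed C.
Proof. by move=> CP x /closure_rnormP; apply: CP. Qed.

Lemma rnorm_pair_le V W (x : V) (y : W) : rnorm (x, y) <= rnorm x + rnorm y.
Proof.
rewrite -lecR -normE rmorphD /= -!normE prod_normE /=.
by rewrite /Num.max; case: ifP; rewrite ?lerDl ?lerDr.
Qed.

Lemma rnorm_fst_le V W (p : V * W) : rnorm p.1 <= rnorm p.
Proof.
rewrite -lecR -!normE prod_normE /=.
by rewrite comparable_le_max ?lexx// real_comparable ?normr_real.
Qed.

Lemma rnorm_snd_le V W (p : V * W) : rnorm p.2 <= rnorm p.
Proof.
rewrite -lecR -!normE prod_normE /=.
by rewrite comparable_le_max ?lexx ?orbT// real_comparable ?normr_real.
Qed.

Lemma cvg_right0_rnormP V (f : R -> V) l :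
  f h @[h --> 0^'+] --> l <-> forall e : R, 0 < e ->
    exists2 d : R, 0 < d & forall h, 0 < h -> h < d -> rnorm (f h - l) < e.
Proof.
split=> [/cvgrPdist_lt fl e e0|fl].
  have /fl[d /= d0 fd] : 0 < e%:C%C by rewrite ltcR.
  exists d => // h h0 hd; rewrite -ltcR -normE distrC; apply: fd => //=.
  by rewrite sub0r normrN gtr0_norm.
apply/cvgrPdist_lt => e e0.
have e_real : e = (complex.Re e)%:C%C by rewrite RRe_real// gtr0_real.
have [|d d0 fd] := fl (complex.Re e); first by rewrite -ltcR -e_real.
exists d => //= h /=; rewrite sub0r normrN => hd h0.
by rewrite distrC normE e_real ltcR fd// (le_lt_trans (ler_norm _)).
Qed.

Lemma continuous_linear_rnorm V W (f : {linear V -> W}) : continuous f ->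
  exists2 K : R, 0 <= K & forall x, rnorm (f x) <= K * rnorm x.
Proof.
move=> cf.
have /linear_boundedP fb : bounded_near f (nbhs 0).
  exact/linear_bounded_continuous.
have [r r0 fr] := pinfty_ex_gt0 fb.
have r_real : r = (complex.Re r)%:C%C by rewrite RRe_real// gtr0_real.
exists (complex.Re r); first by rewrite -lecR -r_real ltW.
by move=> x; rewrite -lecR rmorphM /= -!normE -r_real.
Qed.

Lemma bounded_operator_rnorm V W (f : V -> W) : bounded_operator f ->
  exists2 K : R, 0 <= K & forall x, rnorm (f x) <= K * rnorm x.
Proof.
move=> [lf cf].
pose F : {linear V -> W} := HB.pack f (GRing.isLinear.Build _ _ _ _ _ lf).
exact: (@continuous_linear_rnorm _ _ F).
Qed.

Lemma cauchy_rnorm (V : completeNormedModType R[i]) (u : nat -> V) :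
  (forall e : R, 0 < e -> exists n0 : nat, forall n m : nat,
    (n0 <= n)%N -> (n0 <= m)%N -> rnorm (u n - u m) < e) ->
  exists l, forall e : R, 0 < e -> exists n0 : nat, forall n : nat,
    (n0 <= n)%N -> rnorm (u n - l) < e.
Proof.
move=> uC; have /cauchy_cvg /cvg_ex[l /cvgrPdist_lt ul] : cauchy (u @ \oo).
  apply/cauchyP => e e0.
  have e_real : e = (complex.Re e)%:C%C by rewrite RRe_real// gtr0_real.
  have [|n0 un0] := uC (complex.Re e); first by rewrite -ltcR -e_real.
  exists (u n0), n0 => // n /= n0n.
  by rewrite -ball_normE /= normE e_real ltcR un0.
exists l => e e0.
have /ul[n0 _ un0] : 0 < e%:C%C by rewrite ltcR.
by exists n0 => n n0n; rewrite -ltcR -normE distrC; apply: un0.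
Qed.

End RealNorm.

(** * Inner products and the Cauchy-Schwarz inequality *)

Section InnerProducts.
Variables (R : realType) (H : hilbertType R).
Implicit Types x y z : H.

Lemma innerC x y : '[x, y] = ('[y, x])^*.
Proof. by rewrite hermC expr0 mul1r. Qed.

Lemma inner_rnorm x : '[x, x] = (rnorm x ^+ 2)%:C%C.
Proof. by rewrite inner_norm normE -rmorphXn. Qed.

Lemma Re_innerC x y : complex.Re '[x, y] = complex.Re '[y, x].
Proof. by rewrite innerC; case: ('[y, x]). Qed.

Lemma rnormD2 x y :
  rnorm (x + y) ^+ 2 = rnorm x ^+ 2 + 2 * complex.Re '[x, y] + rnorm y ^+ 2.
Proof.
have -> : rnorm (x + y) ^+ 2 = complex.Re '[x + y, x + y].
  by rewrite inner_rnorm.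
rewrite !linearDl !linearDr /= !raddfD /= (Re_innerC y x).
by rewrite !inner_rnorm /=; ring.
Qed.

Lemma rnormB2 x y :
  rnorm (x - y) ^+ 2 = rnorm x ^+ 2 - 2 * complex.Re '[x, y] + rnorm y ^+ 2.
Proof. by rewrite rnormD2 linearNr raddfN rnormN /=; ring. Qed.

(** This is the cross term in the square of the triangle inequality. *)
Lemma Re_inner_le x y : complex.Re '[x, y] <= rnorm x * rnorm y.
Proof.
have := rnormD x y; rewrite -(@ler_pXn2r _ 2) ?nnegrE ?addr_ge0 ?rnorm_ge0//.
by rewrite rnormD2; nra.
Qed.

Lemma cauchy_schwarz x y : cnorm '[x, y] <= rnorm x * rnorm y.
Proof.
set c := '[x, y].
have [c0|] := eqVneq (cnorm c) 0; first by rewrite c0 mulr_ge0 ?rnorm_ge0.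
rewrite neq_lt ltNge cnorm_ge0 /= => c0.
(* Multiplying [y] by [c] turns the inner product into the real number [|c|^2]. *)
have := Re_inner_le x (c *: y); rewrite linearZr /= -/c rnormZ.
have -> : complex.Re (c^* * c) = cnorm c ^+ 2.
  by rewrite mulrC mulCJ.
by rewrite mulrCA expr2 ler_pM2l.
Qed.

Lemma inner_eq0 x : (forall y, '[y, x] = 0) -> x = 0.
Proof.
move=> /(_ x); rewrite inner_rnorm => -[] /eqP.
by rewrite sqrf_eq0 => /eqP /rnorm_eq0.
Qed.

Lemma innerDl z x y : '[x + y, z] = '[x, z] + '[y, z].
Proof. by rewrite linearDl. Qed.

Lemma innerNl z x : '[- x, z] = - '[x, z].
Proof. by rewrite linearNl. Qed.

Lemma innerZl z a x : '[a *: x, z] = a * '[x, z].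
Proof. by rewrite linearZl. Qed.

Lemma inner0l z : '[0, z] = 0.
Proof. by rewrite linear0l. Qed.

Lemma innerDr z x y : '[z, x + y] = '[z, x] + '[z, y].
Proof. by rewrite linearDr. Qed.

Lemma innerNr z x : '[z, - x] = - '[z, x].
Proof. by rewrite linearNr. Qed.

Lemma innerZr z a x : '[z, a *: x] = a^* * '[z, x].
Proof. by rewrite linearZr. Qed.

Lemma inner0r z : '[z, 0] = 0.
Proof. by rewrite linear0r. Qed.

Lemma inner_inj x y : (forall z, '[x, z] = '[y, z]) -> x = y.
Proof.
move=> xy; apply/subr0_eq/inner_eq0 => z.
by rewrite innerC innerDl innerNl xy subrr rmorph0.
Qed.

End InnerProducts.

(* Vector identities become scalar ones by pairing with an arbitrary vector. *)
Ltac inner_ring := apply: inner_inj => ?;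
  rewrite ?(innerDl, innerNl, innerZl, inner0l); ring.

(** * Orthogonal vectors, the Riesz theorem and dense spans *)

Section HilbertSpaces.
Variables (R : realType) (H : hilbertType R).
Implicit Types x y z : H.

(** Points of nearly minimal norm in the [C n] form a Cauchy sequence: the midpoint of two of them
    lies in an earlier set, so it is not much shorter, and the parallelogram law makes them close.
    This takes the place of weak compactness of balls. *)
Lemma nested_convex_meet (C : nat -> set H) (M : R) :
    (forall n, closed (C n)) -> (forall n m, (n <= m)%N -> C m `<=` C n) ->
    (forall n x y, C n x -> C n y -> C n ((2^-1)%:C%C *: (x + y))) ->
    (forall n, exists2 x, C n x & rnorm x <= M) ->
  exists y, forall n, C n y.
Proof.
move=> C_closed C_decr C_mid C_nonempty.
(* [inf B] is the supremum over [n] of the squared distance from 0 to [C n]. *)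
pose B := [set r : R | forall n, exists2 x, C n x & rnorm x ^+ 2 <= r].
have B_lb : lbound B 0.
  by move=> r /(_ 0%N)[x _]; apply: le_trans; rewrite sqr_ge0.
have BM : B (M ^+ 2).
  move=> n; have [x Cx xM] := C_nonempty n; exists x => //.
  by rewrite ler_pXn2r ?nnegrE ?(le_trans _ xM) ?rnorm_ge0.
have B_inf : has_inf B by split; [exists (M ^+ 2) | exists 0].
pose s := inf B.
have /choice[w wP] n : exists x, C n x /\ rnorm x ^+ 2 <= s + n.+1%:R^-1.
  have [|r Br rs] := @inf_adherent _ B n.+1%:R^-1 _ B_inf.
    by rewrite invr_gt0.
  by have [x Cx xr] := Br n; exists x; split=> //; apply/(le_trans xr)/ltW.
have [|l wl] := @cauchy_rnorm _ _ w.
  (* The squared norms will be below [s + e'] and that of the midpoint above [s - e'], so that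
     [|w n - w m|^2 < 8 e']. *)
  move=> e e0; pose e' := e ^+ 2 / 16.
  have e'0 : 0 < e' by rewrite divr_gt0// exprn_gt0.
  have [n0 n0P] : exists n0, forall x, C n0 x -> s - e' < rnorm x ^+ 2.
    apply: contrapT => /forallNP nP.
    have /(inf_lbound B_inf.2) : B (s - e').
      move=> n; have /existsNP[x /not_implyP[Cx /negP]] := nP n.
      by rewrite -leNgt => xs; exists x.
    by rewrite -/s; lra.
  have [k kP] := @ltr_add_invr _ 0 e' e'0; rewrite add0r in kP.
  exists (maxn n0 k) => n m; rewrite !geq_max => /andP[n0n kn] /andP[n0m km].
  have inv_le j : (k <= j)%N -> j.+1%:R^-1 < e'.
    move=> kj; apply: le_lt_trans kP.
    by rewrite lef_pV2 ?posrE ?ltr0n// ler_nat.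
  have [[Cn wn] [Cm wm]] := (wP n, wP m).
  have := n0P _ (C_mid _ _ _ (C_decr _ _ n0n _ Cn) (C_decr _ _ n0m _ Cm)).
  rewrite rnormZr exprMn ger0_norm ?invr_ge0// rnormD2.
  have := rnormB2 (w n) (w m); have := inv_le _ kn; have := inv_le _ km.
  move: wn wm; rewrite -[_ < e](@ltr_pXn2r _ 2) ?nnegrE ?rnorm_ge0 ?(ltW e0)//.
  have -> : (2^-1 : R) ^+ 2 = 1 / 4 by field.
  have -> : e ^+ 2 = 16 * e' by rewrite /e'; field.
  move: n.+1%:R^-1 m.+1%:R^-1 => u v; move: e'0; lra.
exists l => n; apply: closed_rnorm => // e e0.
have [n0 n0P] := wl e e0; exists (w (maxn n n0)).
  by apply: (C_decr _ _ (leq_maxl n n0)); have [] := wP (maxn n n0).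
by apply: n0P; rewrite leq_maxr.
Qed.

Definition subspace (M : set H) :=
  M 0 /\ forall (a : R[i]) x y, M x -> M y -> M (a *: x + y).

(** The vector is the difference of [p] and its projection on [M], obtained as a common point of the
    sets of almost shortest elements of [p - M]. *)
Lemma exists_orthogonal (M : set H) p : subspace M -> closed M -> ~ M p ->
  exists2 q, q <> 0 & forall m, M m -> '[m, q] = 0.
Proof.
move=> [M0 M_lin] M_closed nMp.
pose B := [set rnorm (p - m) ^+ 2 | m in M].
have B_inf : has_inf B.
  by split; [exists (rnorm (p - 0) ^+ 2), 0 | exists 0 => _ [m _ <-]; rewrite sqr_ge0].
pose d := inf B.
have dP m : M m -> d <= rnorm (p - m) ^+ 2.
  by move=> Mm; apply: (inf_lbound B_inf.2); exists m.
pose C n := [set w | M (p - w) /\ rnorm w ^+ 2 <= d + n.+1%:R^-1].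
(* A norm [r] with [r^2 <= d + 1] satisfies [r <= d + 2], since [2 r <= r^2 + 1] and [0 <= d]. *)
have [||||y yC] := @nested_convex_meet C (d + 1 + 1).
- move=> n; apply: rnorm_closed => x Cx; split.
    apply: closed_rnorm => // e /Cx[z [Mz _] zx]; exists (p - z) => //.
    by rewrite (_ : _ - _ = x - z) 1?rnormBC//; inner_ring.
  rewrite leNgt; apply/negP => dx.
  set r := d + _ in dx; have r0 : 0 <= r.
    by have [z [_ zr] _] := Cx 1 ltr01; apply: le_trans zr; rewrite sqr_ge0.
  have sx : Num.sqrt r < rnorm x.
    by rewrite -(@ltr_pXn2r _ 2) ?nnegrE ?rnorm_ge0 ?sqrtr_ge0// sqr_sqrtr.
  have [|z [_ zr] zx] := Cx (rnorm x - Num.sqrt r); first by rewrite subr_gt0.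
  have : rnorm z <= Num.sqrt r.
    by rewrite -(@ler_pXn2r _ 2) ?nnegrE ?rnorm_ge0 ?sqrtr_ge0// sqr_sqrtr.
  have := rnormB x z 0; rewrite !subr0 rnormBC; lra.
- move=> n m nm x [Mx xm]; split=> //; apply: (le_trans xm).
  by rewrite lerD2l lef_pV2 ?posrE ?ltr0n// ler_nat.
- move=> n x y [Mx xn] [My yn]; split.
    have half : (2^-1)%:C%C * 2 = 1 :> R[i].
      by rewrite fmorphV rmorph_nat mulVf ?pnatr_eq0.
    have -> : p - (2^-1)%:C%C *: (x + y) =
        (2^-1)%:C%C *: (p - x) + ((2^-1)%:C%C *: (p - y) + 0).
      by rewrite -[p in LHS]scale1r -half; inner_ring.
    by apply: (M_lin) => //; apply: M_lin.
  rewrite rnormZr exprMn ger0_norm ?invr_ge0// rnormD2.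
  have -> : (2^-1 : R) ^+ 2 = 1 / 4 by field.
  have := sqr_ge0 (rnorm (x - y)); rewrite rnormB2.
  move: n.+1%:R^-1 xn yn => u xn yn; lra.
- move=> n; have [|r [m Mm <-] rd] := @inf_adherent _ B n.+1%:R^-1 _ B_inf.
    by rewrite invr_gt0.
  have n1 : n.+1%:R^-1 <= 1 :> R by rewrite invf_le1 ?ltr0n// ler1n.
  have d0 : 0 <= d by apply: lb_le_inf B_inf.1 _ => _ [m' _ <-]; rewrite sqr_ge0.
  exists (p - m); first by split; [rewrite opprB addrC subrK | exact: ltW].
  have := sqr_ge0 (rnorm (p - m) - 1); move: rd n1; rewrite -/d.
  by move: n.+1%:R^-1 => u; nra.
have yd : rnorm y ^+ 2 <= d.
  rewrite leNgt; apply/negP => /ltr_add_invr[k].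
  by rewrite ltNge; apply/negP; rewrite negbK; have [] := yC k.
have My : M (p - y) by have [] := yC 0%N.
exists y; first by move=> y0; apply: nMp; rewrite y0 subr0 in My.
move=> m Mm; apply: cnorm_eq0; set c := '[m, y].
have min_y (a : R[i]) : rnorm y ^+ 2 <= rnorm (y - a *: m) ^+ 2.
  apply: (le_trans yd).
  have -> : y - a *: m = p - (a *: m + (p - y)).
    by inner_ring.
  by apply/dP/M_lin.
(* With this [t], subtracting [t c^* m] from [y] lowers [|y|^2] by at least [t |c|^2], so minimality
   forces [c = 0]. *)
pose t : R := (rnorm m ^+ 2 + 1)^-1.
have m0 : 0 < rnorm m ^+ 2 + 1 by rewrite ltr_wpDl ?sqr_ge0.
have t0 : 0 < t by rewrite invr_gt0.
have := min_y (t%:C%C * c^*); rewrite rnormB2 innerZr innerC -/c.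
have -> : (t%:C%C * c^*)^* * c^* = (t * cnorm c ^+ 2)%:C%C.
  by rewrite rmorphM /= conjCK conjCr -mulrA mulCJ -rmorphM.
rewrite rnormZ cnormM cnormC cnormJ (gtr0_norm t0) /= => tc.
have tm : t * rnorm m ^+ 2 <= 1.
  by rewrite -ler_pdivlMl// invrK mulr1 lerDl.
have c2 : t * cnorm c ^+ 2 <= 0 by have := cnorm_ge0 c; nra.
have : cnorm c ^+ 2 <= 0 by rewrite -(pmulr_rle0 _ t0).
by rewrite exprn_even_le0//= => /eqP.
Qed.

Lemma riesz (l : H -> R[i]) :
  (forall a x y, l (a *: x + y) = a * l x + l y) ->
  (exists2 K : R, 0 <= K & forall x, cnorm (l x) <= K * rnorm x) ->
  exists q, forall x, l x = '[x, q].
Proof.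
move=> l_lin [K K0 lK].
have l0 : l 0 = 0.
  apply: (@addrI _ (l 0)); rewrite addr0 -{3}[0](addr0 0) -{3}(scale1r 0).
  by rewrite l_lin mul1r.
have lB x y : l (x - y) = l x - l y.
  by rewrite addrC -scaleN1r l_lin mulN1r addrC.
have [ker|/existsNP[p lp]] := pselect (forall x, l x = 0).
  by exists 0 => x; rewrite ker inner0r.
have [|||q q0 qP] := @exists_orthogonal [set x | l x = 0] p.
- by split=> //= a x y lx ly; rewrite l_lin lx ly mulr0 addr0.
- apply: rnorm_closed => x lx; apply: cnorm_eq0; apply/eqP.
  rewrite eq_le cnorm_ge0 andbT; apply/ler_addgt0Pr => e e0.
  have [|y /= ly yx] := lx (e / (K + 1)); first by rewrite divr_gt0// ltr_wpDl.
  have -> : l x = - l (y - x) by rewrite lB ly sub0r opprK.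
  rewrite cnormN add0r (le_trans (lK _))//.
  rewrite ltr_pdivlMr ?ltr_wpDl// in yx.
  have := rnorm_ge0 (y - x); nra.
- exact: lp.
have qq0 : '[q, q] != 0.
  apply: contra_notN q0 => /eqP; rewrite inner_rnorm => -[] /eqP.
  by rewrite sqrf_eq0 => /eqP /rnorm_eq0.
(* The scalar comes from pairing [l q *: x - l x *: q], an element of the kernel, with [q]. *)
exists ((l q / '[q, q])^* *: q) => x; rewrite innerZr conjCK.
have /eqP : '[l q *: x - l x *: q, q] = 0.
  by apply: qP; rewrite /= lB -[_ *: x]addr0 -[_ *: q]addr0 !l_lin l0; ring.
rewrite innerDl innerNl !innerZl subr_eq0 => /eqP lqx.
by rewrite mulrAC lqx mulfK.
Qed.

Lemma subspace_lspan (A : set H) : subspace (lspan A).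
Proof.
split; first by exists 0%N, (fun=> 0), (fun=> 0); split=> [[]//|]; rewrite big_ord0.
move=> a x y [n [b [v [Av ->]]]] [m [c [w [Aw ->]]]].
exists (n + m)%N, (fun k => match fintype.split k with inl i => a * b i | inr j => c j end),
  (fun k => match fintype.split k with inl i => v i | inr j => w j end).
split; first by move=> k; case: fintype.split.
rewrite big_split_ord /= scaler_sumr; congr (_ + _).
  by apply: eq_bigr => i _; rewrite -[lshift _ _]/(unsplit (inl i)) unsplitK scalerA.
by apply: eq_bigr => i _; rewrite -[rshift _ _]/(unsplit (inr i)) unsplitK.
Qed.

Lemma subspace_closure (M : set H) : subspace M -> subspace (closure M).
Proof.
move=> [M0 M_lin]; split; first exact: subset_closure.
move=> a x y /closure_rnormP Mx /closure_rnormP My; apply/closure_rnormP => e e0.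
have a1 : 0 < cnorm a + 1 by rewrite ltr_wpDl ?cnorm_ge0.
have [|x' Mx' xx'] := Mx (e / 2 / (cnorm a + 1)); first by rewrite !divr_gt0.
have [|y' My' yy'] := My (e / 2); first by rewrite divr_gt0.
exists (a *: x' + y'); first exact: M_lin.
rewrite (_ : _ - _ = a *: (x' - x) + (y' - y)); last by inner_ring.
apply: (le_lt_trans (rnormD _ _)); rewrite rnormZ.
rewrite ltr_pdivlMr// in xx'.
have := rnorm_ge0 (x' - x); have := cnorm_ge0 a; nra.
Qed.

Lemma dense_lspan (A : set H) :
  (forall q, (forall x, A x -> '[x, q] = 0) -> q = 0) ->
  closure (lspan A) = setT.
Proof.
move=> Aq; apply/seteqP; split=> // p _; apply: contrapT => nAp.
have [|||q q0 qP] := @exists_orthogonal (closure (lspan A)) p.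
- exact/subspace_closure/subspace_lspan.
- exact: closed_closure.
- exact: nAp.
apply: q0; apply: Aq => x Ax; apply/qP/subset_closure.
by exists 1%N, (fun=> 1), (fun=> x); split=> //; rewrite big_ord1 scale1r.
Qed.

End HilbertSpaces.

Lemma lspan_min (R : realType) (V : lmodType R[i]) (A P : set V) : P 0 ->
  (forall a p q, P p -> P q -> P (a *: p + q)) -> A `<=` P -> lspan A `<=` P.
Proof.
move=> P0 P_lin AP _ [n [a [v [Av ->]]]].
elim/big_ind: _ => //= [p q Pp Pq|i _].
  by rewrite -[p]scale1r; apply: P_lin.
by rewrite -[_ *: _]addr0; apply: P_lin => //; apply/AP/Av.
Qed.

(** For each slope [e > 0], the bound [f r <= f 0 + e r] is pushed along the supremum of the
    interval where it holds: the left hypothesis reaches the supremum and the right one goes past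
    it. *)
Lemma nonincreasing_from_right (R : realType) (f : R -> R) :
  (forall t, 0 <= t -> forall e, 0 < e -> exists2 d, 0 < d &
     forall h, 0 < h -> h < d -> f (t + h) <= f t + e * h) ->
  (forall t M, 0 < t -> (forall s, 0 <= s -> s < t -> f s <= M) -> f t <= M) ->
  forall t, 0 <= t -> f t <= f 0.
Proof.
move=> f_right f_left t; rewrite le_eqVlt => /predU1P[<-//|t0].
apply/ler_addgt0Pr => e' e'0; pose e := e' / t.
have e0 : 0 < e by rewrite divr_gt0.
have -> : e' = e * t by rewrite divfK// gt_eqF.
pose A := [set s | [/\ 0 <= s, s <= t &
  forall r, 0 <= r -> r <= s -> f r <= f 0 + e * r]].
have A0 : A 0.
  split=> // [|r r0 r0']; first exact: ltW.
  by rewrite (@le_anti _ _ r 0) ?r0 ?r0'// mulr0 addr0.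
have A_sup : has_sup A by split; [exists 0 | exists t => s []].
pose s := sup A.
have s0 : 0 <= s by apply: sup_upper_bound.
have st : s <= t by apply: ge_sup; [exists 0 | move=> r []].
have below r : 0 <= r -> r < s -> f r <= f 0 + e * r.
  move=> r0 rs; have [|r' [r'0 r't r'P] rr'] := @sup_adherent _ A (s - r) _ A_sup.
    by rewrite subr_gt0.
  by apply: r'P => //; move: rr'; rewrite -/s; lra.
have at_s : f s <= f 0 + e * s.
  move: s0; rewrite le_eqVlt => /predU1P[<-|s0]; first by rewrite mulr0 addr0.
  apply: f_left => // r r0 rs; apply: (le_trans (below r r0 rs)).
  by rewrite lerD2l ler_pM2l// ltW.
move: st; rewrite le_eqVlt => /predU1P[<-//|st].
have [d d0 dP] := f_right s s0 e e0.
pose s' := Num.min (s + d / 2) t.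
have [s's s't s'd] : [/\ s < s', s' <= t & s' <= s + d / 2].
  by rewrite /s' lt_min !ge_min !lexx orbT ltrDl divr_gt0.
suff : A s' by move=> /(sup_upper_bound A_sup); rewrite -/s leNgt s's.
split=> // [|r r0 rs']; first exact/(le_trans s0)/ltW.
have [rs|sr|->//] := ltgtP r s; first exact: below.
have -> : r = s + (r - s) by rewrite addrC subrK.
apply: (le_trans (dP _ _ _)); [lra|lra|].
by move: at_s; lra.
Qed.

(** * Dissipative operators *)

Section Dissipative.
Variables (R : realType) (X : hilbertType R).
Implicit Types (x z : X) (A : set (X * X)).

(** [Re l |x|^2 <= Re <l x - z, x>], followed by Cauchy-Schwarz. *)
Lemma dissipative_lower_bound x z (l : R[i]) : complex.Re '[z, x] <= 0 ->
  complex.Re l * rnorm x <= rnorm (l *: x - z).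
Proof.
move=> zx; have [x0|x0] := eqVneq (rnorm x) 0.
  by rewrite x0 mulr0 rnorm_ge0.
have xgt0 : 0 < rnorm x by rewrite lt_neqAle eq_sym x0 rnorm_ge0.
rewrite -(ler_pM2r xgt0); apply: le_trans (Re_inner_le _ _).
rewrite innerDl innerNl innerZl inner_rnorm raddfB /=.
by case: l => a b /=; rewrite mulr0 subr0; nra.
Qed.

(** The backward Euler estimate, the form in which dissipativity limits the growth of orbits. *)
Lemma dissipative_step x z (h : R) : 0 <= h -> complex.Re '[z, x] <= 0 ->
  rnorm x <= rnorm (x - h%:C%C *: z).
Proof.
move=> h0 zx; have := @dissipative_lower_bound x (h%:C%C *: z) 1.
rewrite scale1r mul1r; apply.
by rewrite innerZl; case: ('[z, x]) zx => a b /=; nra.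
Qed.

Definition dissipative A := forall x z, A (x, z) -> complex.Re '[z, x] <= 0.

Definition onto_shift A (l : R[i]) :=
  forall f, exists x z, A (x, z) /\ l *: x - z = f.

End Dissipative.

(** * Dissipative generators: contractive semigroup, surjective [l - A] *)

Section Generator.
Variables (R : realType) (X : hilbertType R) (T : R -> X -> X).
Hypothesis T_C0 : C0_semigroup T.
Let A := generator T.
Hypotheses (A_lin : linear_operator A) (A_closed : closed A).
Hypothesis A_diss : dissipative A.
Variable b : R[i].
Hypothesis b_res : resolvent_set A b.
Implicit Types x y z : X.

Let T0 x : T 0 x = x. Proof. by case: T_C0. Qed.

Let TD s t x : 0 <= s -> 0 <= t -> T (s + t) x = T s (T t x).
Proof. by case: T_C0 => _ _ TD _ s0 t0; apply: TD. Qed.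

Let T_lin t a x y : 0 <= t -> T t (a *: x + y) = a *: T t x + T t y.
Proof. by case: T_C0 => + _ _ _ t0 => /(_ t t0)[+ _] => /(_ a x y). Qed.

Let TB t x y : 0 <= t -> T t (x - y) = T t x - T t y.
Proof. by move=> t0; rewrite addrC -scaleN1r T_lin// scaleN1r addrC. Qed.

Let TDl t x y : 0 <= t -> T t (x + y) = T t x + T t y.
Proof. by move=> t0; rewrite -{1}[x]scale1r T_lin// scale1r. Qed.

Let TZ t a x : 0 <= t -> T t (a *: x) = a *: T t x.
Proof.
move=> t0; rewrite -[a *: x]addr0 T_lin//.
have -> : T t 0 = 0 by rewrite -{1}(subrr x) TB// subrr.
by rewrite addr0.
Qed.

Let T_bounded t : 0 <= t ->
  exists2 K : R, 0 <= K & forall x, rnorm (T t x) <= K * rnorm x.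
Proof. by case: T_C0 => Tb _ _ _ t0; apply: bounded_operator_rnorm (Tb t t0). Qed.

Let T_right x (e : R) : 0 < e ->
  exists2 d : R, 0 < d & forall h, 0 < h -> h < d -> rnorm (T h x - x) < e.
Proof. by case: T_C0 => _ _ _ Tr e0; apply: (cvg_right0_rnormP _ _).1 (Tr x) e e0. Qed.

Let genP x z : A (x, z) <-> forall e : R, 0 < e -> exists2 d : R, 0 < d &
  forall h, 0 < h -> h < d -> rnorm (T h x - x - h%:C%C *: z) < e * h.
Proof.
have quot h : 0 < h -> rnorm ((h%:C)%C^-1 *: (T h x - x) - z) =
    h^-1 * rnorm (T h x - x - h%:C%C *: z).
  move=> h0; rewrite (_ : _ - z = (h^-1)%:C%C *: (T h x - x - h%:C%C *: z)).
    by rewrite rnormZr ger0_norm// invr_ge0 ltW.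
  by rewrite fmorphV [RHS]scalerBr scalerA mulVf ?scale1r// fmorph_eq0 gt_eqF.
rewrite /A /generator /=; split=> [/cvg_right0_rnormP Ax e /Ax[d d0 dP]|Ax].
  exists d => // h h0 hd; have := dP h h0 hd.
  by rewrite quot// ltr_pdivrMl// mulrC.
apply/cvg_right0_rnormP => e /Ax[d d0 dP]; exists d => // h h0 hd.
by rewrite quot// ltr_pdivrMl// mulrC dP.
Qed.

Let gen_invariant t x z : 0 <= t -> A (x, z) -> A (T t x, T t z).
Proof.
move=> t0 /genP Axz; apply/genP => e e0.
have [K K0 TK] := T_bounded t0.
have [|d d0 dP] := Axz (e / (K + 1)); first by rewrite divr_gt0// ltr_wpDl.
exists d => // h h0 hd; have h0' := ltW h0.
have -> : T h (T t x) - T t x - h%:C%C *: T t z =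
    T t (T h x - x - h%:C%C *: z).
  rewrite addrC -scaleNr -[in RHS]scaleNr [in RHS]addrC T_lin//; congr (_ + _).
  by rewrite TB// -!TD// (addrC t).
have := dP h h0 hd; rewrite mulrAC ltr_pdivlMr ?ltr_wpDl//.
have := TK (T h x - x - h%:C%C *: z).
have := rnorm_ge0 (T h x - x - h%:C%C *: z); nra.
Qed.

(** For [y = (b - A)^{-1} x] one has [x = b y - A y]; replacing [A y] by the quotient
    [h^{-1} (T h y - y)] gives vectors of the domain that tend to [x]. *)
Let dom_dense x (e : R) : 0 < e -> exists y z, A (y, z) /\ rnorm (y - x) < e.
Proof.
have [Q _ QE] := b_res.
pose y := Q x; pose z := b *: y - x.
have Ayz : A (y, z).
  have : graph_of Q (x, Q x) by [].
  rewrite -QE => -[[y' z'] /= Ayz [yE zE]].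
  by rewrite /z /y -yE -zE opprB addrC subrK.
have /genP Ay := Ayz; move=> /Ay[d d0 dP].
pose h := d / 2; have h0 : 0 < h by rewrite divr_gt0.
have [A0 A_comb _] := A_lin.
have /(A_comb (- (h^-1)%:C%C)) : A (T h y - y, T h z - z).
  have := A_comb (-1) _ _ Ayz (gen_invariant (ltW h0) Ayz).
  by rewrite /= scaleN1r; congr (A (_, _)); rewrite addrC.
move=> /(_ _ (A_comb b _ _ Ayz A0)) /= Aw; do 2!eexists; split; first exact: Aw.
have /dP : h < d by rewrite /h; lra.
move=> /(_ h0); set w := T h y - y; rewrite -/w.
have hh : h%:C%C * (h^-1)%:C%C = 1 :> R[i] by rewrite -rmorphM /= divff// gt_eqF.
have -> : w - h%:C%C *: z =
    (- h%:C)%C *: (- (h^-1)%:C%C *: w + (b *: y + 0) - x).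
  by rewrite -[w in LHS]scale1r -hh /z; inner_ring.
by rewrite rnormZ cnormN cnormC gtr0_norm// mulrC ltr_pM2r.
Qed.

Let closed_le (f : X -> X) (K M : R) : 0 <= K ->
  (forall x y, rnorm (f x - f y) <= K * rnorm (x - y)) ->
  closed [set x | rnorm (f x) <= M].
Proof.
move=> K0 fK; apply: rnorm_closed => x xM; apply/ler_addgt0Pr => e e0.
have [|y /= yM yx] := xM (e / (K + 1)); first by rewrite divr_gt0// ltr_wpDl.
have := fK x y; rewrite ltr_pdivlMr ?ltr_wpDl// rnormBC in yx.
have := rnormB (f x) (f y) 0; rewrite !subr0 rnormBC => fxy.
rewrite (rnormBC x y) => fxy'; rewrite rnormBC in yx.
have := rnorm_ge0 (y - x); nra.
Qed.

(* Without a uniform bound on T near 0, left continuity is not available yet.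
   A point y with |y| <= M and T h y near T t x for every small h > 0 is found
   in a decreasing sequence of bounded closed convex sets. *)
Let orbit_left x t (M : R) : 0 < t ->
  (forall s, 0 <= s -> s < t -> rnorm (T s x) <= M) -> rnorm (T t x) <= M.
Proof.
move=> t0 xM; apply/ler_addgt0Pr => e' e'0.
pose e := e' / 2; have e0 : 0 < e by rewrite divr_gt0.
set v := T t x; have [d0 d00 vd0] := T_right v e0.
pose C n := [set w | rnorm w <= M /\ forall d, t / n.+1%:R < d -> d < d0 ->
  rnorm (T d w - v) <= e].
have tn n : 0 < t / n.+1%:R by rewrite divr_gt0.
have [||||y yC] := @nested_convex_meet _ _ C M.
- move=> n w Cw; split.
    apply: (@closed_le id 1 M) => // [? ?|]; first by rewrite mul1r.
    by apply: closure_subset Cw => z [].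
  move=> d dn dd0; have d_ge0 := ltW (lt_trans (tn n) dn).
  have [K K0 TK] := T_bounded d_ge0.
  apply: (@closed_le (fun w => T d w - v) K e) => //.
    move=> y z; rewrite (_ : _ - _ = T d (y - z)) ?TK//.
    by rewrite TB//; inner_ring.
  by apply: closure_subset Cw => z [_ zP]; apply: zP.
- move=> n m nm w [wM wP]; split=> // d dn; apply: wP; apply: le_lt_trans dn.
  by rewrite ler_pM2l// lef_pV2 ?posrE ?ltr0n// ler_nat.
- move=> n y z [yM yP] [zM zP]; split.
    by rewrite rnormZr ger0_norm ?invr_ge0//; have := rnormD y z; lra.
  move=> d dn dd0; have d_ge0 := ltW (lt_trans (tn n) dn).
  have -> : T d ((2^-1)%:C%C *: (y + z)) - v =
      (2^-1)%:C%C *: ((T d y - v) + (T d z - v)).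
    have half : (2^-1)%:C%C * 2 = 1 :> R[i].
      by rewrite fmorphV rmorph_nat mulVf ?pnatr_eq0.
    rewrite TZ// TDl//.
    by rewrite -[v in LHS]scale1r -half; inner_ring.
  rewrite rnormZr ger0_norm ?invr_ge0//; have := rnormD (T d y - v) (T d z - v).
  have := yP d dn dd0; have := zP d dn dd0; lra.
- move=> n; have tt : t / n.+1%:R <= t.
    by rewrite ler_pdivrMr// ler_peMr ?(ltW t0)// ler1n.
  (* For this witness [w], [T d w] is [T (d - t / n.+1) v], which is within [e] of [v] because
     [0 < d - t / n.+1 < d0]. *)
  exists (T (t - t / n.+1%:R) x).
    split=> [|d dn dd0]; first by apply: xM; rewrite ?subr_ge0// ltrBlDr ltrDl.
    rewrite -TD ?subr_ge0//; last exact/ltW/(lt_trans (tn n)).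
    rewrite addrA [d + t]addrC -addrA addrC TD ?subr_ge0 ?(ltW dn) ?(ltW t0)//.
    apply/ltW/vd0; first by rewrite subr_gt0.
    by apply: lt_trans dd0; rewrite ltrBlDr ltrDl.
  by apply: xM; rewrite ?subr_ge0// ltrBlDr ltrDl.
(* For small [d > 0] the point [T d y] is within [e] of both [y] and [v], whence
   [|v| <= M + 2 e]. *)
have [d1 d10 yd1] := T_right y e0.
pose d := Num.min d0 d1 / 2.
have d_gt0 : 0 < d by rewrite divr_gt0// lt_min d00.
have [dd0 dd1] : d < d0 /\ d < d1.
  have [? ?] : Num.min d0 d1 <= d0 /\ Num.min d0 d1 <= d1.
    by rewrite !ge_min !lexx orbT.
  by split; rewrite /d; lra.
have [k kd] : exists k, t / k.+1%:R < d.
  have [|k] := @ltr_add_invr _ 0 (d / t); first by rewrite divr_gt0.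
  by rewrite add0r => kP; exists k; rewrite mulrC -ltr_pdivlMr.
have [yM /(_ d kd dd0) yv] := yC k.
have := yd1 d d_gt0 dd1; have := rnormB v (T d y) y; have := rnormB v y 0.
rewrite !subr0 (rnormBC v (T d y)) /e in yv *; lra.
Qed.

(** With [y = T t x], the backward Euler estimate gives [|T h y| <= |T h y - h A T h y|], and the
    right side is at most [|y| + o(h)] because [A T h y = T h A y] tends to [A y]. *)
Let contraction_dom x z t : 0 <= t -> A (x, z) -> rnorm (T t x) <= rnorm x.
Proof.
move=> t0 Axz; rewrite -[in leRHS](T0 x).
apply: (@nonincreasing_from_right _ (fun t => rnorm (T t x))) t0.
  move=> {}t t0 e e0; set y := T t x; set w := T t z.
  have Ayw : A (y, w) by exact: gen_invariant.
  have e20 : 0 < e / 2 by rewrite divr_gt0.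
  have [d1 d10 d1P] := (genP y w).1 Ayw _ e20.
  have [d2 d20 d2P] := T_right w e20.
  exists (Num.min d1 d2); first by rewrite lt_min d10.
  move=> h h0; rewrite lt_min => /andP[hd1 hd2].
  rewrite addrC TD ?(ltW h0)// -/y.
  have Ah := gen_invariant (ltW h0) Ayw.
  have := dissipative_step (ltW h0) (A_diss Ah).
  rewrite (_ : T h y - _ = y + ((T h y - y - h%:C%C *: w)
    + h%:C%C *: (w - T h w))); last by inner_ring.
  have := d1P h h0 hd1; have := d2P h h0 hd2; rewrite rnormBC.
  have := rnormD y (T h y - y - h%:C%C *: w + h%:C%C *: (w - T h w)).
  have := rnormD (T h y - y - h%:C%C *: w) (h%:C%C *: (w - T h w)).
  rewrite rnormZr gtr0_norm//; nra.
by move=> s M s0; apply: orbit_left.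
Qed.

Let contraction x t : 0 <= t -> rnorm (T t x) <= rnorm x.
Proof.
move=> t0; apply/ler_addgt0Pr => e e0; have [K K0 TK] := T_bounded t0.
have [|y [z [Ayz yx]]] := @dom_dense x (e / (K + 1)).
  by rewrite divr_gt0// ltr_wpDl.
have := contraction_dom t0 Ayz; have := TK (x - y); rewrite TB//.
rewrite ltr_pdivlMr ?ltr_wpDl// rnormBC in yx.
have := rnormB (T t x) (T t y) 0; have := rnormB y x 0; rewrite !subr0 (rnormBC y x).
have := rnorm_ge0 (x - y); nra.
Qed.

(** Dissipativity bounds [|x|] by a multiple of [|l x - A x|], so the preimages of a convergent
    sequence are Cauchy, and [A] is closed. *)
Let range_closed (l : R[i]) : 0 < complex.Re l ->
  closed [set f | exists x z, A (x, z) /\ l *: x - z = f].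
Proof.
move=> l0; have [_ A_comb _] := A_lin.
apply: rnorm_closed => f f_adh.
have /choice[u uP] n : exists p : X * X,
    A p /\ rnorm (l *: p.1 - p.2 - f) < n.+1%:R^-1.
  have [|g [x [z [Axz gE]]] gf] := f_adh n.+1%:R^-1; first by rewrite invr_gt0.
  by exists (x, z); rewrite /= gE.
have [|x xP] := @cauchy_rnorm _ _ (fun n => (u n).1).
  move=> e e0; have [|k kP] := @invr_nat_lt R (complex.Re l * e / 2).
    by rewrite divr_gt0// mulr_gt0.
  exists k => n m kn km; have [[Aun un] [Aum um]] := (uP n, uP m).
  have := A_comb (-1) _ _ Aum Aun; move: (u n) (u m) Aun Aum un um.
  move=> [x1 z1] [x2 z2] /= _ _ un um Adiff.
  have := dissipative_lower_bound l (A_diss Adiff).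
  rewrite (_ : l *: _ - _ = (l *: x1 - z1 - f) - (l *: x2 - z2 - f)); last by inner_ring.
  rewrite (_ : -1 *: x2 + x1 = x1 - x2); last by inner_ring.
  have := rnormD (l *: x1 - z1 - f) (- (l *: x2 - z2 - f)); rewrite rnormN.
  have := kP n kn; have := kP m km; move: n.+1%:R^-1 m.+1%:R^-1 un um => a c.
  nra.
exists x, (l *: x - f); split; last by inner_ring.
apply: closed_rnorm => // e e0.
have c0 := cnorm_ge0 l.
have [|n0 n0P] := xP (e / (2 * (1 + cnorm l))).
  by rewrite divr_gt0// mulr_gt0// ltr_pwDl.
have [|k kP] := @invr_nat_lt R (e / 2); first by rewrite divr_gt0.
pose n := maxn n0 k; have [Aun un] := uP n; exists (u n) => //.
apply: (le_lt_trans (rnorm_pair_le _ _)) => /=.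
rewrite (_ : (u n).2 - _ = l *: ((u n).1 - x) - (l *: (u n).1 - (u n).2 - f));
  last by inner_ring.
have := rnormD (l *: ((u n).1 - x)) (- (l *: (u n).1 - (u n).2 - f)).
rewrite rnormN rnormZ.
have := n0P n (leq_maxl _ _).
rewrite ltr_pdivlMr ?mulr_gt0 ?ltr_pwDl//; have := kP n (leq_maxr _ _).
move: n.+1%:R^-1 un => a; clearbody n; lra.
Qed.

Lemma generator_onto_shift (l : R[i]) : 0 < complex.Re l -> onto_shift A l.
Proof.
move=> l0 f; have [A0 A_comb _] := A_lin.
apply: contrapT => nf.
have [|||q q0 qP] :=
    @exists_orthogonal _ _ [set f | exists x z, A (x, z) /\ l *: x - z = f] f.
- split; first by exists 0, 0; split=> //; rewrite scaler0 subr0.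
  move=> a _ _ [x [z [Axz <-]]] [x' [z' [Axz' <-]]].
  exists (a *: x + x'), (a *: z + z'); split; last by inner_ring.
  by have := A_comb a _ _ Axz Axz'.
- exact: range_closed.
- exact: nf.
(* For [x] in the domain, [<T t x, q>] thus formally has derivative [l] times itself. *)
have qA x z : A (x, z) -> '[z, q] = l * '[x, q].
  move=> Axz; have /eqP := qP _ (ex_intro _ x (ex_intro _ z (conj Axz erefl))).
  by rewrite innerDl innerNl innerZl subr_eq0 => /eqP.
have dom_orth x z : A (x, z) -> '[x, q] = 0.
  move=> Axz; pose a := complex.Re l; pose F t := cnorm '[T t x, q].
  (* [<T h y, q> = (1 + h l) <y, q> + o(h)] and [|1 + h l| >= 1 + a h]. *)
  have F_right (t : R) : 0 <= t -> forall e : R, 0 < e -> exists2 d : R, 0 < d &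
      forall h, 0 < h -> h < d -> F t * (1 + a * h) <= F (t + h) + e * h.
    move=> t0 e e0; set y := T t x; set w := T t z.
    have Ayw : A (y, w) by exact: gen_invariant.
    have [|d d0 dP] := (genP y w).1 Ayw (e / (rnorm q + 1)).
      by rewrite divr_gt0// ltr_wpDl ?rnorm_ge0.
    exists d => // h h0 hd; rewrite /F (addrC t) TD ?(ltW h0)// -/y.
    have hl : 1 + a * h <= cnorm (1 + h%:C%C * l).
      apply: le_trans (Re_le_cnorm _); apply: le_trans (ler_norm _).
      by rewrite raddfD /=; case: (l) @a => u v /=; rewrite mul0r subr0; lra.
    have yE : (1 + h%:C%C * l) * '[y, q] =
        '[T h y, q] - '[T h y - y - h%:C%C *: w, q].
      by rewrite !(innerDl, innerNl, innerZl) (qA _ _ Ayw); ring.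
    have := dP h h0 hd; rewrite mulrAC ltr_pdivlMr ?ltr_wpDl ?rnorm_ge0//.
    have := cauchy_schwarz (T h y - y - h%:C%C *: w) q.
    have := cnormD '[T h y, q] (- '[T h y - y - h%:C%C *: w, q]).
    rewrite cnormN -yE cnormM.
    have := rnorm_ge0 (T h y - y - h%:C%C *: w); have := rnorm_ge0 q.
    have := ler_wpM2r (cnorm_ge0 '[y, q]) hl; lra.
  (* Contractivity now gives left continuity, as [T t x - T (t - h) x = T (t - h) (T h x - x)]. The
     slope [c] will be 0, then [a F 0]. *)
  have F_left (t M c : R) : 0 < t ->
      (forall s : R, 0 <= s -> s < t -> - F s + c * s <= M) -> - F t + c * t <= M.
    move=> t0 FM; apply/ler_addgt0Pr => e e0.
    have [|d d0 dP] := @T_right x (e / 2 / (rnorm q + 1)).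
      by rewrite !divr_gt0// ltr_wpDl ?rnorm_ge0.
    pose k := Num.min t (Num.min d (e / 2 / (`|c| + 1))).
    have k0 : 0 < k.
      by rewrite !lt_min t0 d0 !divr_gt0// ltr_wpDl.
    have [kt kd ke] : [/\ k <= t, k <= d & k <= e / 2 / (`|c| + 1)].
      by rewrite /k !ge_min !lexx !orbT.
    pose h := k / 2; have h0 : 0 < h by rewrite divr_gt0.
    have hk : h < k by rewrite /h; lra.
    have th : 0 <= t - h by lra.
    have := FM (t - h) th; rewrite gtrBl => /(_ h0).
    have := dP h h0 (lt_le_trans hk kd).
    have TE : T t x - T (t - h) x = T (t - h) (T h x - x).
      by rewrite TB// -TD ?subrK// ltW.
    have := contraction (T h x - x) th; rewrite -TE.
    have := cauchy_schwarz (T t x - T (t - h) x) q; rewrite innerDl innerNl.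
    have := cnormD '[T t x, q] (- ('[T t x, q] - '[T (t - h) x, q])).
    rewrite cnormN opprB [X in cnorm X <= _]addrC subrK -/(F t) -/(F (t - h)).
    have : c * h <= e / 2.
      have := ler_norm c; rewrite ler_pdivlMr ?ltr_wpDl// in ke.
      have := normr_ge0 c; nra.
    rewrite ltr_pdivlMr ?ltr_wpDl ?rnorm_ge0//.
    have := rnorm_ge0 q; have := rnorm_ge0 (T h x - x); nra.
  have F_ge0 t : 0 <= F t by exact: cnorm_ge0.
  have F_incr (t : R) : 0 <= t -> F 0 <= F t.
    rewrite -[_ <= F t]lerN2; apply: (@nonincreasing_from_right _ (fun t => - F t)).
      move=> {}t t0 e e0; have [d d0 dP] := F_right t t0 e e0.
      exists d => // h h0 hd; have := dP h h0 hd; have := F_ge0 t; rewrite -/a in l0.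
      have : 0 <= a * h by rewrite mulr_ge0 ?ltW.
      nra.
    move=> {}t M t0 FM; have := F_left t M 0 t0; rewrite mul0r addr0; apply.
    by move=> s s0 st; rewrite mul0r addr0; apply: FM.
  (* Since [F] stays above [F 0], it grows at rate at least [a F 0]. *)
  have F_lin (t : R) : 0 <= t -> - F t + (a * F 0) * t <= - F 0.
    move=> t0; rewrite -[leRHS]addr0 -[X in _ <= _ + X](mulr0 (a * F 0)).
    apply: (@nonincreasing_from_right _ (fun t => - F t + (a * F 0) * t)) t0.
      move=> {}t t0 e e0; have [d d0 dP] := F_right t t0 e e0.
      exists d => // h h0 hd; have := dP h h0 hd; have := F_incr t t0.
      rewrite -/a in l0; have : 0 <= a * h by rewrite mulr_ge0 ?ltW.
      nra.
    by move=> {}t M t0; apply: F_left.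
  have F_bound (t : R) : 0 <= t -> F t <= rnorm x * rnorm q.
    move=> t0; apply: le_trans (cauchy_schwarz _ _) _.
    by rewrite ler_wpM2r ?rnorm_ge0 ?contraction.
  have F0 : F 0 = 0.
    apply: contrapT => /eqP F0; have {}F0 : 0 < F 0 by rewrite lt_neqAle eq_sym F0 F_ge0.
    have aF : 0 < a * F 0 by rewrite mulr_gt0.
    (* At this time the lower bound [F 0 + a F 0 t] exceeds the upper bound [|x| |q|]. *)
    pose t := (rnorm x * rnorm q + 1) / (a * F 0).
    have t0 : 0 <= t.
      by rewrite divr_ge0 ?ltW// ltr_wpDl ?mulr_ge0 ?rnorm_ge0.
    have := F_lin t t0; have := F_bound t t0.
    rewrite /t [_ * (_ / _)]mulrC divfK ?gt_eqF//; lra.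
  by apply: cnorm_eq0; rewrite -[x]T0.
apply: q0; apply: inner_eq0 => x; apply: cnorm_eq0; apply/eqP.
rewrite eq_le cnorm_ge0 andbT; apply/ler_addgt0Pr => e e0; rewrite add0r.
have [|y [z [/dom_orth yq yx]]] := @dom_dense x (e / (rnorm q + 1)).
  by rewrite divr_gt0// ltr_wpDl ?rnorm_ge0.
have := cauchy_schwarz (y - x) q; rewrite innerDl innerNl yq add0r cnormN.
rewrite ltr_pdivlMr ?ltr_wpDl ?rnorm_ge0// in yx.
have := rnorm_ge0 (y - x); nra.
Qed.

End Generator.

(** * Polarization of the energy balance *)

Section EnergyBalance.
Variables (R : realType) (X U Y : hilbertType R).
Implicit Types S : set ((X * U) * (X * Y)).

(** The adjoint graph has this property whether or not it is single-valued. *)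
Definition linear_graph (V W : lmodType R[i]) (G : set (V * W)) :=
  forall (a : R[i]) p q, G p -> G q -> G (a *: p + q).

(** The Hermitian form [<z, x> + <x, z> - <u, u> + <y, y>] vanishes on [S]. Evaluated at [p + p'] it
    kills the sum of the two cross terms, at [i p + p'] their difference. *)
Lemma energy_polarized S x u z y x' u' z' y' :
  linear_graph S -> energy_preserving S ->
  S ((x, u), (z, y)) -> S ((x', u'), (z', y')) ->
  '[z, x'] + '[x, z'] = '[u, u'] - '[y, y'].
Proof.
move=> S_lin S_energy Sp Sp'.
have diag x1 u1 z1 y1 : S ((x1, u1), (z1, y1)) ->
    '[z1, x1] + '[x1, z1] - '[u1, u1] + '[y1, y1] = 0.
  move=> /S_energy; rewrite -!inner_norm ReE mulrC divfK ?pnatr_eq0//.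
  by rewrite -innerC => ->; ring.
have := diag _ _ _ _ Sp; have := diag _ _ _ _ Sp'.
have := diag _ _ _ _ (S_lin 1 _ _ Sp Sp').
have := diag _ _ _ _ (S_lin 'i _ _ Sp Sp').
rewrite !(innerDl, innerDr, innerZl, innerZr) conjCi rmorph1.
have i2 : 'i * 'i = -1 :> R[i] by rewrite -expr2 sqrCi.
have i0 : 'i != 0 :> R[i] by rewrite neq0Ci.
set p1 := '[z, x']; set p2 := '[x, z']; set p3 := '[u, u']; set p4 := '[y, y'].
set q1 := '[z', x]; set q2 := '[x', z]; set q3 := '[u', u]; set q4 := '[y', y].
have cancel (a c d g : R[i]) : a = 0 -> c = 0 -> d = 0 -> g = a - c - d -> g = 0.
  by move=> -> -> -> ->; rewrite !subr0.
have i2' t : 'i * (- 'i * t) = t :> R[i].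
  by rewrite mulNr mulrN mulrA i2 mulN1r opprK.
rewrite !i2' /= => hi h1 h' h.
have s1 : (p1 + p2 - p3 + p4) + (q1 + q2 - q3 + q4) = 0.
  by apply: (cancel _ _ _ _ h1 h h'); ring.
have s2 : (p1 + p2 - p3 + p4) - (q1 + q2 - q3 + q4) = 0.
  by apply: (mulfI i0); rewrite mulr0; apply: (cancel _ _ _ _ hi h h'); ring.
have : (p1 + p2 - p3 + p4) *+ 2 = 0.
  by rewrite -[RHS]addr0 -{1}s1 -s2 mulr2n; ring.
move/eqP; rewrite mulrn_eq0 /= => /eqP s0.
by apply/subr0_eq; rewrite -s0; ring.
Qed.

Lemma linear_graph_adjoint S : linear_graph (graph_adjoint S).
Proof.
move=> a p q Gp Gq r Sr /=.
by rewrite !linearDr /= !linearZr /= Gp// Gq.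
Qed.

Lemma graph_adjointP S x' y' z' u' :
  graph_adjoint S ((x', y'), (z', u')) <->
  forall x u z y, S ((x, u), (z, y)) ->
    '[z, x'] + '[y, y'] = '[x, z'] + '[u, u'].
Proof.
split=> [Sd x u z y Sp|Sd [[x u] [z y]] Sp]; first exact: (Sd _ Sp).
exact: Sd Sp.
Qed.

Lemma graph_adjoint_flip S x u z y : linear_graph S -> energy_preserving S ->
  S ((x, u), (z, y)) -> graph_adjoint S ((x, y), (- z, u)).
Proof.
move=> S_lin S_energy Sp; apply/graph_adjointP => x' u' z' y' Sp'.
have := energy_polarized S_lin S_energy Sp' Sp; rewrite innerNr.
move=> h; apply/subr0_eq.
rewrite (_ : _ - _ = '[z', x] + '[x', z] - ('[u', u] - '[y', y])); last by ring.
by rewrite h subrr.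
Qed.

Lemma energy_rnorm S x u z y : energy_preserving S -> S ((x, u), (z, y)) ->
  2 * complex.Re '[z, x] = rnorm u ^+ 2 - rnorm y ^+ 2.
Proof.
move=> S_energy /S_energy; rewrite !normE ReE -ReJ_add.
rewrite -!rmorphXn -rmorphB -(rmorph_nat (real_complex R)) -rmorphM.
exact: complexI.
Qed.

End EnergyBalance.

(** * Density of the domain and resolvents in the extrapolation space *)

Section DissipativeDomain.
Variables (R : realType) (X : hilbertType R) (A : set (X * X)).
Hypotheses (A_lin : linear_operator A) (A_diss : dissipative A).

(** Solve [x - A x = q]: orthogonality of [q] to [x] gives [|x|^2 = Re <A x, x> <= 0]. *)
Lemma dissipative_dom_orth q : onto_shift A 1 ->
  (forall x z, A (x, z) -> '[x, q] = 0) -> q = 0.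
Proof.
move=> A_onto Aq; have [x [z [Axz xz]]] := A_onto q.
have x0 : x = 0.
  apply: rnorm_eq0; apply/eqP; rewrite -sqrf_eq0.
  have := A_diss Axz; have : '[q, x] = 0 by rewrite innerC (Aq _ _ Axz) rmorph0.
  rewrite -xz innerDl innerNl innerZl inner_rnorm mul1r => /subr0_eq <- /=.
  by move=> x2; rewrite eq_le x2 sqr_ge0.
have [A0 _ A_fun] := A_lin; rewrite x0 in Axz.
by rewrite -xz x0 scaler0 add0r (A_fun _ _ _ Axz A0) oppr0.
Qed.

Lemma dissipative_dom_dense x (e : R) : onto_shift A 1 -> 0 < e ->
  exists y z, A (y, z) /\ rnorm (y - x) < e.
Proof.
move=> A_onto e0; pose D := [set x | exists z, A (x, z)].
have [A0 A_comb _] := A_lin.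
have : closure D x.
  apply: contrapT => nDx; have [|||q q0 qP] := @exists_orthogonal _ _ (closure D) x.
  - apply: subspace_closure; split; first by exists 0.
    by move=> a y y' [z Ayz] [z' Ayz']; exists (a *: z + z'); apply: A_comb Ayz Ayz'.
  - exact: closed_closure.
  - exact: nDx.
  apply/q0/dissipative_dom_orth => // y z Ayz.
  by apply/qP/subset_closure; exists z.
by move/closure_rnormP => /(_ e e0)[y [z Ayz] yx]; exists y, z.
Qed.

Variable Xm1 : extrapolation A.

(* [l - A_{-1}] is injective: [|x| <= C |(l - A_{-1}) x|] holds on [dom A] by the
   resolvent identity, hence everywhere since [dom A] is dense. *)
Lemma extra_resolventE (l : R[i]) x w :
  (forall l, 0 < complex.Re l -> onto_shift A l) -> 0 < complex.Re l ->
  l *: extra_emb Xm1 x - extra_op Xm1 x = w -> extra_resolvent l w = x.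
Proof.
move=> A_onto l0.
pose h x := l *: extra_emb Xm1 x - extra_op Xm1 x.
have [Q Qb QE] := extra_pointP Xm1; set b := extra_point Xm1 in QE.
have [KQ KQ0 QK] := bounded_operator_rnorm Qb.
have embE y : rnorm (extra_emb Xm1 y) = rnorm (Q y).
  rewrite /rnorm extra_emb_norm /resolvent QE /gapply; congr (complex.Re `|_|).
  by apply: xget_subset1 => // ? ?; rewrite /graph_of /= => -> ->.
have [Ko Ko0 oK] := continuous_linear_rnorm (@extra_op_continuous _ _ _ Xm1).
have h_bounded y : rnorm (h y) <= (cnorm l * KQ + Ko) * rnorm y.
  have := rnormD (l *: extra_emb Xm1 y) (- extra_op Xm1 y).
  rewrite rnormN rnormZ embE; have := oK y; have := QK y; have := cnorm_ge0 l.
  rewrite -/(h y); nra.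
have hB y y' : h (y - y') = h y - h y'.
  rewrite /h (linearB (extra_emb Xm1)) (linearB (extra_op Xm1)) scalerBr.
  by rewrite !opprB addrACA [RHS]addrACA; congr (_ + _); apply: addrC.
have [A0 A_comb _] := A_lin.
have h_lower y z : A (y, z) ->
    complex.Re l * rnorm y <= (complex.Re l + cnorm (b - l)) * rnorm (h y).
  move=> Ayz; set f := l *: y - z.
  have -> : rnorm (h y) = rnorm (Q f).
    rewrite -embE; congr rnorm.
    by rewrite (linearB (extra_emb Xm1)) linearZ /= /h (extra_opE _ Ayz).
  have AQ : A (Q f, b *: Q f - f).
    have : graph_of Q (f, Q f) by [].
    rewrite -QE => -[[y' z'] /= Ayz' [yE zE]].
    by rewrite -yE -zE opprB addrC subrK.
  (* [l - A] sends [y - Q f] to [(b - l) Q f], which bounds [|y - Q f|] by a multiple of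
     [|Q f| = |h y|]. *)
  have := dissipative_lower_bound l (A_diss (A_comb (-1) _ _ AQ Ayz)).
  rewrite (_ : l *: _ - _ = (b - l) *: Q f); last by rewrite /f; inner_ring.
  rewrite rnormZ (_ : -1 *: _ + y = y - Q f); last by inner_ring.
  have := rnormB y (Q f) 0; rewrite !subr0; have := rnorm_ge0 (y - Q f).
  nra.
have h_inj y : h y = 0 -> y = 0.
  move=> hy; apply: rnorm_eq0; apply/eqP; rewrite eq_le rnorm_ge0 andbT.
  apply/ler_addgt0Pr => e e0; rewrite add0r.
  pose C := (complex.Re l + cnorm (b - l)) * (cnorm l * KQ + Ko).
  have C0 : 0 <= C.
    by rewrite mulr_ge0 ?addr_ge0 ?mulr_ge0 ?cnorm_ge0// ltW.
  have [||y' [z' [Ay' y'y]]] :=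
      @dissipative_dom_dense y (e * complex.Re l / (complex.Re l + C)).
  - by apply: A_onto; rewrite ltr01.
  - by rewrite divr_gt0 ?mulr_gt0// ltr_pwDl.
  have := h_lower _ _ Ay'; rewrite -[h y']subr0 -hy -hB.
  have := ler_wpM2l (addr_ge0 (ltW l0) (cnorm_ge0 (b - l))) (h_bounded (y' - y)).
  rewrite mulrA -/C; rewrite ltr_pdivlMr ?ltr_pwDl// in y'y.
  have := rnormB y y' 0; rewrite !subr0 (rnormBC y).
  move=> yy' h1 h2.
  rewrite -(ler_pM2l l0); have := rnorm_ge0 (y' - y); nra.
move=> hx; rewrite /extra_resolvent /gapply; apply: xget_subset1 => //= y y' hy hy'.
by apply/subr0_eq/h_inj; rewrite hB /h -hy -hy' subrr.
Qed.

End DissipativeDomain.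

(** * Conservative nodes and their adjoints *)

Section ConservativeNode.
Variables (R : realType) (U X Y : hilbertType R).
Variable S : set ((X * U) * (X * Y)).
Hypotheses (S_node : system_node S) (S_conservative : conservative S).
Let A := main_operator S.
Let Sd := graph_adjoint S.
Variable Xm1 : extrapolation A.

Lemma node_linear_graph : linear_graph S.
Proof. by have [[_ S_comb _] _ _ _ _] := S_node. Qed.

Let S_comb (a : R[i]) x u z y x' u' z' y' :
  S ((x, u), (z, y)) -> S ((x', u'), (z', y')) ->
  S ((a *: x + x', a *: u + u'), (a *: z + z', a *: y + y')).
Proof. exact: (@node_linear_graph a (_, _) (_, _)). Qed.

Let S_energy : energy_preserving S. Proof. by case: S_conservative. Qed.

Let Sd_energy : energy_preserving Sd. Proof. by case: S_conservative. Qed.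

Lemma node_functional v w w' : S (v, w) -> S (v, w') -> w = w'.
Proof. by have [[_ _ S_fun] _ _ _ _] := S_node; apply: S_fun. Qed.

Lemma main_operator_linear : linear_operator A.
Proof.
have [[S0 _ S_fun] _ _ _ _] := S_node; split.
- by exists 0.
- move=> a [x z] [x' z'] [y Sy] [y' Sy']; exists (a *: y + y').
  by have := S_comb a Sy Sy'; rewrite scaler0 addr0.
- move=> x z z' [y Sy] [y' Sy'].
  by have [] := S_fun _ _ _ Sy Sy'.
Qed.

Lemma main_operator_dissipative : dissipative A.
Proof.
move=> x z [y /= Sy]; have := energy_rnorm S_energy Sy.
rewrite rnorm0 expr0n /= sub0r => h; have := sqr_ge0 (rnorm y); lra.
Qed.

(** Closedness of [A] is that of [A&B] at input 0, and the point defining [Xm1] is the resolvent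
    point behind the density of the domain. *)
Lemma main_operator_onto l : 0 < complex.Re l -> onto_shift A l.
Proof.
have [_ _ AB_closed [T T_C0 AE] _] := S_node.
have A_closed : closed A.
  apply: rnorm_closed => -[x z] A_adh.
  apply: closed_rnorm AB_closed _ => e e0.
  have [|[x' z'] Ax'z' d] := A_adh (e / 2); first by rewrite divr_gt0.
  exists ((x', 0), z') => //; apply: le_lt_trans (rnorm_pair_le _ _) _ => /=.
  have xx' : rnorm (x' - x) <= rnorm ((x', z') - (x, z)) .
    exact: (rnorm_fst_le ((x', z') - (x, z))).
  have zz' : rnorm (z' - z) <= rnorm ((x', z') - (x, z)) .
    exact: (rnorm_snd_le ((x', z') - (x, z))).
  have : rnorm ((x', 0 : U) - (x, 0)) <= rnorm (x' - x) + rnorm (0 - 0 : U).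
    exact: rnorm_pair_le.
  rewrite (subr0 (0 : U)) rnorm0; lra.
have A_lin := main_operator_linear; have A_diss := main_operator_dissipative.
move: (extra_point Xm1) (extra_pointP Xm1) => b A_res; rewrite /A AE in A_lin A_diss A_closed A_res *.
exact: (generator_onto_shift T_C0 A_lin A_closed A_diss A_res).
Qed.

(** Any point of the domain with input [u] is corrected by an element of [dom A], which has input
    0. *)
Lemma node_onto l f u : 0 < complex.Re l ->
  exists x z y, S ((x, u), (z, y)) /\ l *: x - z = f.
Proof.
move=> l0; have [_ _ _ _ S_dom] := S_node.
have [x0 [[z0 y0] S0]] := S_dom u.
have [x [z [[y Sx] xz]]] := main_operator_onto l0 (f - (l *: x0 - z0)).
exists (1 *: x + x0), (1 *: z + z0), (1 *: y + y0); split.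
  by have := S_comb 1 Sx S0; rewrite scaler0 add0r.
have -> : l *: (1 *: x + x0) - (1 *: z + z0) = (l *: x - z) + (l *: x0 - z0).
  by inner_ring.
by rewrite xz subrK.
Qed.

(* Compares the given element of [S^*] with the flip of the solution in [S] of
   [x' - z' = x + z] with input [u]: the energy balance of [S^*] forces their
   difference to vanish. *)
Lemma adjoint_node_flip x u z y : Sd ((x, y), (z, u)) -> S ((x, u), (- z, y)).
Proof.
move=> Sdp; have [|x' [z' [y' [Sp' xz']]]] := @node_onto 1 (x + z) u.
  exact: ltr01.
have Sdp' := graph_adjoint_flip node_linear_graph S_energy Sp'.
have := linear_graph_adjoint (-1) Sdp' Sdp.
set w := -1 *: x' + x; have z'E : z' = x' - (x + z).
  by rewrite -xz'; inner_ring.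
have -> : -1 *: (x', y', (- z', u)) + (x, y, (z, u)) =
    ((w, y - y'), (- w, 0)).
  congr ((_, _), (_, _)).
  - by inner_ring.
  - by rewrite /= z'E /w; inner_ring.
  - by inner_ring.
(* The balance reads [- 2 |w|^2 = |y - y'|^2], so both sides vanish. *)
move=> /(energy_rnorm Sd_energy); rewrite innerNl inner_rnorm raddfN /= rnorm0.
have := sqr_ge0 (rnorm w); have := sqr_ge0 (rnorm (y - y')).
move=> yy0 ww0 wy.
have /rnorm_eq0 w0 : rnorm w = 0 by apply/eqP; rewrite -sqrf_eq0; apply/eqP; lra.
have /rnorm_eq0/subr0_eq -> : rnorm (y - y') = 0.
  by apply/eqP; rewrite -sqrf_eq0; apply/eqP; lra.
have xE : x = x' by apply/subr0_eq; rewrite -w0 /w; inner_ring.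
rewrite xE (_ : - z = z'); first exact: Sp'.
by rewrite z'E xE; inner_ring.
Qed.

(** In the energy balance with [z = l x - f], the cross term is absorbed by
    [2 |f| |x| <= a |x|^2 + |f|^2 / a], where [a = Re l]. *)
Lemma resolvent_bound l x u z y f : 0 < complex.Re l ->
  S ((x, u), (z, y)) -> l *: x - z = f ->
  complex.Re l * rnorm x ^+ 2 + rnorm y ^+ 2 <=
    rnorm u ^+ 2 + rnorm f ^+ 2 / complex.Re l.
Proof.
move=> l0 Sp xz; have := energy_rnorm S_energy Sp.
have -> : z = l *: x - f by rewrite -xz; inner_ring.
rewrite innerDl innerNl innerZl inner_rnorm raddfB /=.
case: l l0 {xz} => a b /= a0; rewrite mulr0 subr0.
have := Re_inner_le f x; move: (complex.Re _) => t.
have : 2 * rnorm f * rnorm x <= a * rnorm x ^+ 2 + rnorm f ^+ 2 / a.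
  rewrite -subr_ge0 (_ : _ - _ = (a * rnorm x - rnorm f) ^+ 2 / a).
    by rewrite divr_ge0 ?sqr_ge0// ltW.
  by field; rewrite gt_eqF.
lra.
Qed.

(** The equation for [S^*] at [l] is dual to that for [S] at [m = l^*]: if [g] is the bounded
    solution map of the latter, the components of the Riesz representative of [p |-> <g p, (x, c)>]
    form the solution of the former. *)
Lemma adjoint_node_onto l x c : 0 < complex.Re l ->
  exists f z u, Sd ((f, c), (z, u)) /\ l *: f - z = x.
Proof.
move=> l0; pose m := l^*.
have mE : complex.Re m = complex.Re l by rewrite /m; case: (l).
have m0 : 0 < complex.Re m by rewrite mE.
have /choice[g gP] (p : X * U) : exists q : X * Y,
    S ((q.1, p.2), (m *: q.1 - p.1, q.2)).
  have [x' [z [y [Sp xz]]]] := node_onto p.1 p.2 m0.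
  by exists (x', y); rewrite /= -xz opprB addrC subrK.
have g_uniq p x' y : S ((x', p.2), (m *: x' - p.1, y)) -> g p = (x', y).
  move=> Sp; have := S_comb (-1) Sp (gP p); case: (g p) => x1 y1 /=.
  case: p Sp => f u /= Sp h; have := resolvent_bound m0 h erefl.
  rewrite (_ : -1 *: u + u = 0) 1?(_ : m *: (-1 *: x' + x1) - _ = 0); try by inner_ring.
  rewrite !rnorm0 expr0n /= mul0r addr0 => le0.
  have := sqr_ge0 (rnorm (-1 *: x' + x1)); have := sqr_ge0 (rnorm (-1 *: y + y1)).
  move=> yy xx; have /rnorm_eq0 y0 : rnorm (-1 *: y + y1) = 0.
    by apply/eqP; rewrite -sqrf_eq0 eq_le yy andbT; nra.
  have /rnorm_eq0 x0 : rnorm (-1 *: x' + x1) = 0.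
    by apply/eqP; rewrite -sqrf_eq0 eq_le xx andbT; nra.
  congr pair; apply/subr0_eq; [rewrite -x0|rewrite -y0]; inner_ring.
pose F p := '[(g p).1, x] + '[(g p).2, c].
have F_lin a p q : F (a *: p + q) = a * F p + F q.
  rewrite /F (@g_uniq _ (a *: (g p).1 + (g q).1) (a *: (g p).2 + (g q).2)) /=.
    by rewrite !innerDl !innerZl; ring.
  have := S_comb a (gP p) (gP q).
  rewrite (_ : m *: _ - _ = a *: (m *: (g p).1 - p.1) + (m *: (g q).1 - q.1)) //.
  by inner_ring.
(* For [s = |p.1| + |p.2|] the energy estimate is at most [k s^2]; as [k] is at least 1 and at least
   [1 / Re m], both components of [g p] are bounded by [k s]. *)
pose k := (complex.Re m)^-1 + 1.
have F_bound p :
    cnorm (F p) <= k * (rnorm x + rnorm c) * (rnorm p.1 + rnorm p.2).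
  have /(resolvent_bound m0 (gP p)) : m *: (g p).1 - (m *: (g p).1 - p.1) = p.1.
    by inner_ring.
  set x1 := (g p).1; set y1 := (g p).2.
  have := rnorm_ge0 p.1; have := rnorm_ge0 p.2.
  move: (rnorm p.1) (rnorm p.2) => nf nu nu0 nf0 bound.
  have i0 : 0 < (complex.Re m)^-1 by rewrite invr_gt0.
  have ai : complex.Re m * (complex.Re m)^-1 = 1 by rewrite divff ?gt_eqF.
  have k0 : 0 <= k by rewrite /k; lra.
  have s2 : nu ^+ 2 + nf ^+ 2 / complex.Re m <= k * (nf + nu) ^+ 2.
    have := mulr_ge0 nf0 nu0; have := mulr_ge0 (ltW i0) (mulr_ge0 nf0 nu0).
    have := sqr_ge0 nf; have := mulr_ge0 (ltW i0) (sqr_ge0 nu).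
    by rewrite /k; move: (complex.Re m)^-1 => i; lra.
  have ks : k * (nf + nu) ^+ 2 <= (k * (nf + nu)) ^+ 2.
    by rewrite exprMn ler_wpM2r ?sqr_ge0// /k; nra.
  have kn : 0 <= k * (nf + nu) by apply: mulr_ge0 => //; apply: addr_ge0.
  have y1_le : rnorm y1 <= k * (nf + nu).
    rewrite -(@ler_pXn2r _ 2) ?nnegrE ?rnorm_ge0//.
    by have := sqr_ge0 (rnorm x1); nra.
  have x1_le : rnorm x1 <= k * (nf + nu).
    rewrite -(@ler_pXn2r _ 2) ?nnegrE ?rnorm_ge0//.
    have x2 : complex.Re m * rnorm x1 ^+ 2 <= k * (nf + nu) ^+ 2.
      by have := sqr_ge0 (rnorm y1); lra.
    have := ler_wpM2l (ltW i0) x2; rewrite mulrA mulVf ?gt_eqF// mul1r.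
    rewrite exprMn => /le_trans; apply; rewrite mulrA ler_wpM2r ?sqr_ge0//.
    by rewrite /k; nra.
  apply: le_trans (cnormD _ _) _.
  have := cauchy_schwarz x1 x; have := cauchy_schwarz y1 c.
  have := ler_wpM2r (rnorm_ge0 x) x1_le; have := ler_wpM2r (rnorm_ge0 c) y1_le.
  lra.
have kxc : 0 <= k * (rnorm x + rnorm c).
  by rewrite mulr_ge0 ?addr_ge0 ?rnorm_ge0 ?invr_ge0 ?ler01// ltW.
(* The product carries the max norm, so the functional is represented in each component
   separately. *)
have [||f fP] := riesz (l := fun f0 => F (f0, 0)).
- move=> a f f'; rewrite -F_lin; congr F; congr pair.
  by rewrite /= scaler0 addr0.
- exists (k * (rnorm x + rnorm c)) => // f.
  by have := F_bound (f, 0); rewrite /= rnorm0 addr0.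
have [||u uP] := riesz (l := fun u0 => F (0, u0)).
- move=> a u u'; rewrite -F_lin; congr F; congr pair.
  by rewrite /= scaler0 addr0.
- exists (k * (rnorm x + rnorm c)) => // u.
  by have := F_bound (0, u); rewrite /= rnorm0 add0r.
exists f, (l *: f - x), u; split; last by inner_ring.
apply/graph_adjointP => x' u' z' y' Sp.
have gE : g (m *: x' - z', u') = (x', y').
  by apply: g_uniq => /=; rewrite opprB addrC subrK.
have : F (m *: x' - z', u') = '[m *: x' - z', f] + '[u', u].
  rewrite -fP -uP -[F (_, 0)]mul1r -F_lin; congr F; congr pair.
    by rewrite /= scale1r addr0.
  by rewrite /= scaler0 add0r.
rewrite /F gE /= innerDl innerNl innerZl => h.
rewrite innerDr innerNr innerZr -/m; apply/subr0_eq.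
by move/eqP: h; rewrite -subr_eq0 => /eqP <-; ring.
Qed.

Lemma main_operator_dom_orth q : (forall x z, A (x, z) -> '[x, q] = 0) -> q = 0.
Proof.
apply: dissipative_dom_orth.
- exact: main_operator_linear.
- exact: main_operator_dissipative.
- by apply: main_operator_onto; rewrite ltr01.
Qed.

Lemma adjoint_main_operator_sub x z u : Sd ((x, 0), (z, u)) -> graph_adjoint A (x, z).
Proof.
move=> /graph_adjointP Sdp [x' z'] [y' /= Sp].
by have := Sdp _ _ _ _ Sp; rewrite inner0r inner0l !addr0.
Qed.

(** [1 - A^*] is injective because [1 - A] is onto, so [x] coincides with the solution in [S^*] of
    the equation with the same right-hand side. *)
Lemma adjoint_main_operator x z : graph_adjoint A (x, z) ->
  exists u, Sd ((x, 0), (z, u)).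
Proof.
move=> Ad; have l0 : 0 < complex.Re (1 : R[i]) by exact: ltr01.
have [x' [z' [u' [Sdp' xz']]]] := adjoint_node_onto (1 *: x - z) 0 l0.
have Ad' := adjoint_main_operator_sub Sdp'.
pose w := x - x'; have wz : z - z' = w.
  have -> : z' = 1 *: x' - (1 *: x - z) by rewrite -xz'; inner_ring.
  by rewrite /w; inner_ring.
have [x1 [z1 [Axz1 xz1]]] := main_operator_onto l0 w.
have w0 : w = 0.
  apply: rnorm_eq0; apply/eqP; rewrite -sqrf_eq0.
  have := Ad _ Axz1; have := Ad' _ Axz1 => /= h' h.
  have : '[z1, w] - '[x1, w] = 0.
    by rewrite -{2}wz /w !innerDr !innerNr h h' subrr.
  move=> /(congr1 (fun t => complex.Re (- t))); rewrite oppr0 opprB -innerNl -innerDl.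
  by rewrite -[x1 in x1 - _]scale1r xz1 inner_rnorm /= => ->.
exists u'; have -> : x = x' by apply/subr0_eq.
by have -> : z = z' by apply/subr0_eq; rewrite wz.
Qed.

Lemma adjoint_main_operator_linear : linear_operator (graph_adjoint A).
Proof.
split.
- by move=> q _; rewrite /= !linear0r.
- by move=> a p q Ap Aq r Ar; rewrite /= !linearDr /= !linearZr /= Ap// Aq.
- move=> x z z' Az Az'; apply/subr0_eq/main_operator_dom_orth => x1 z1 Axz1.
  by have := Az _ Axz1; have := Az' _ Axz1; rewrite /= innerDr innerNr => -> ->; rewrite subrr.
Qed.

Lemma adjoint_main_operator_dissipative : dissipative (graph_adjoint A).
Proof.
move=> x z /adjoint_main_operator[u Sdp]; have := energy_rnorm Sd_energy Sdp.
rewrite rnorm0 expr0n /= sub0r => h; have := sqr_ge0 (rnorm u); lra.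
Qed.

Lemma adjoint_main_operator_onto l : 0 < complex.Re l -> onto_shift (graph_adjoint A) l.
Proof.
move=> l0 x; have [f [z [u [Sdp fz]]]] := adjoint_node_onto x 0 l0.
by exists f, z; split=> //; apply: adjoint_main_operator_sub Sdp.
Qed.

End ConservativeNode.

(** * Difference quotients and their diagonal values *)

Section DifferenceQuotient.
Variables (R : realType) (V X : hilbertType R).

(* At [m = a] the derivative of [f] is minus the Riesz representative of
   [w |-> '[g a w, x]]; the Lipschitz bound on [g] gives convergence in norm. *)
Lemma inner_diff_quotient (f : R[i] -> V) (x : X) (g : R[i] -> V -> X)
    (a m : R[i]) (K L : R) w :
  0 < complex.Re a -> 0 < complex.Re m -> 0 <= L ->
  (forall b w w', g a (b *: w + w') = b *: g a w + g a w') ->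
  (forall w, rnorm (g a w) <= K * rnorm w) ->
  (forall m w, 0 < complex.Re m ->
    complex.Re m * rnorm (g m w - g a w) <= cnorm (m - a) * (L * rnorm w)) ->
  (forall m w, 0 < complex.Re m -> (m - a) * '[x, g m w] = '[f a - f m, w]) ->
  '[diff_quotient f m a, w] = '[x, g m w].
Proof.
move=> a0 m0 L0 g_lin gK gL fg.
rewrite /diff_quotient; case: eqVneq => [->|ma]; last first.
  by rewrite innerZl -fg// mulKf// subr_eq0.
have [||d dP] := riesz (l := fun w => '[g a w, x]).
- by move=> b y y'; rewrite g_lin innerDl innerZl.
- exists (`|K| * rnorm x) => [|y]; first by rewrite mulr_ge0 ?rnorm_ge0.
  apply: le_trans (cauchy_schwarz _ _) _.
  rewrite mulrAC ler_wpM2r ?rnorm_ge0//; apply: le_trans (gK y) _.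
  by rewrite ler_wpM2r ?rnorm_ge0// ler_norm.
suff -> : derive1 f a = - d by rewrite opprK innerC -dP -innerC.
(* The factor [2 / Re a] bounds [1 / Re (h + a)] once [|h| < Re a / 2]. *)
pose M := rnorm x * L * 2 / complex.Re a.
have M0 : 0 <= M by rewrite divr_ge0 ?mulr_ge0 ?rnorm_ge0 ?(ltW a0).
apply: cvg_lim => //; apply/cvgrPdist_lt => e e0.
have e_real : e = (complex.Re e)%:C%C by rewrite RRe_real// gtr0_real.
pose r := complex.Re e; have r0 : 0 < r by rewrite -ltcR -e_real.
have d1 : 0 < (complex.Re a / 2)%:C%C :> R[i] by rewrite ltcR divr_gt0.
have d2 : 0 < (r / (M + 1))%:C%C :> R[i] by rewrite ltcR divr_gt0// ltr_wpDl.
near=> h.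
have h0 : h != 0 by near: h; apply: nbhs_dnbhs_neq.
have hd1 : cnorm h < complex.Re a / 2.
  by rewrite -ltcR -cnormE; near: h; apply: dnbhs0_lt.
have hd2 : cnorm h < r / (M + 1).
  by rewrite -ltcR -cnormE; near: h; apply: dnbhs0_lt.
have ha : complex.Re a / 2 < complex.Re (h + a).
  have := le_lt_trans (Re_le_cnorm h) hd1; rewrite ltr_norml raddfD /=; lra.
have ha0 : 0 < complex.Re (h + a) by lra.
rewrite normE e_real ltcR -/r -rnormN opprB opprK.
set q := h^-1 *: _; set s := q + d.
(* The scalar identity is tested at the error [s] itself; the Lipschitz bound then gives
   [|s|^2 <= M |h| |s|]. *)
have sP : '[s, s] = '[x, g a s - g (h + a) s].
  rewrite innerDl innerDr innerNr addrC; congr (_ + _).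
    by rewrite innerC -dP -innerC.
  rewrite innerZl -opprB innerNl -fg// addrK.
  by rewrite mulrN mulKf.
have := cauchy_schwarz x (g a s - g (h + a) s).
rewrite -sP inner_rnorm cnormC ger0_norm ?sqr_ge0//.
have := gL (h + a) s ha0; rewrite addrK rnormBC.
set t := rnorm (_ - _) => ht sx.
have t0 : 0 <= t by rewrite rnorm_ge0.
have x0 := rnorm_ge0 x; have s0 := rnorm_ge0 s; have hc0 := cnorm_ge0 h.
have t_le : complex.Re a * t <= 2 * cnorm h * L * rnorm s by nra.
have s_le : rnorm s ^+ 2 <= M * cnorm h * rnorm s.
  have MA : complex.Re a * M = rnorm x * L * 2.
    by rewrite /M; field; rewrite gt_eqF.
  rewrite -(ler_pM2l a0).
  have -> : complex.Re a * (M * cnorm h * rnorm s) =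
      rnorm x * L * 2 * cnorm h * rnorm s by rewrite -MA; ring.
  have := ler_wpM2l (ltW a0) sx; have := ler_wpM2l x0 t_le; lra.
rewrite ltr_pdivlMr ?ltr_wpDl// in hd2.
have [->|s_neq0] := eqVneq (rnorm s) 0; first by [].
have s_gt0 : 0 < rnorm s by rewrite lt_neqAle eq_sym s_neq0.
rewrite expr2 ler_pM2r// in s_le; nra.
Unshelve. all: by end_near.
Qed.

End DifferenceQuotient.

Lemma adjointE (R : realType) (V W : hilbertType R) (f : V -> W) w v :
  (forall x, '[f x, w] = '[x, v]) -> adjoint f w = v.
Proof.
move=> fwv; apply: xget_subset1 => [[x y]|v1 v2 /= h1 h2].
  by rewrite /graph_of /= => ->.
apply/subr0_eq/inner_eq0 => x; rewrite innerDr innerNr.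
have := h1 (x, f x) erefl; have := h2 (x, f x) erefl => /= <- <-.
by rewrite subrr.
Qed.

(** [t^-1 + 1] stands in for the square root of [t^-1], which it dominates. *)
Lemma square_bound (R : realFieldType) (t x c : R) :
  0 < t -> 0 <= x -> 0 <= c -> t * x ^+ 2 <= c ^+ 2 -> x <= (t^-1 + 1) * c.
Proof.
move=> t0 x0 c0 txc; have i0 : 0 < t^-1 by rewrite invr_gt0.
rewrite -(@ler_pXn2r _ 2) ?nnegrE ?mulr_ge0 ?addr_ge0 ?ler01// ?(ltW i0)//.
have := ler_wpM2l (ltW i0) txc; rewrite mulrA mulVf ?gt_eqF// mul1r exprMn.
move=> /le_trans; apply; rewrite ler_wpM2r ?sqr_ge0//.
by move: t^-1 i0 => i i0; nra.
Qed.

(** * The bilateral input map: isometry, intertwinement, simplicity *)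

Section BilateralInputMap.
Variables (R : realType) (U X Y : hilbertType R).
Variable S : set ((X * U) * (X * Y)).
Hypotheses (S_node : system_node S) (S_conservative : conservative S).
Variable Xm1 : extrapolation (main_operator S).
Variable B : U -> Xm1.
Hypothesis B_control : control_operator S B.
Variable Xdm1 : extrapolation (graph_adjoint (main_operator S)).
Variable Cstar : Y -> Xdm1.
Hypothesis Cstar_control : control_operator (graph_adjoint S) Cstar.
Let phi := transfer_function S B.
Let Sd := graph_adjoint S.
Let S_energy : energy_preserving S := S_conservative.1.
Let Sd_energy : energy_preserving Sd := S_conservative.2.
Let S_lin : linear_graph S := node_linear_graph S_node.
Let x1 l c := extra_resolvent l (Cstar c).
Let x2 l v := extra_resolvent l (B v).

Let x2E l x v : 0 < complex.Re l ->
  l *: extra_emb Xm1 x - extra_op Xm1 x = B v -> x2 l v = x.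
Proof.
move=> l0; apply: extra_resolventE => //.
- exact: main_operator_linear.
- exact: main_operator_dissipative.
- by move=> m; apply: main_operator_onto.
Qed.

Let x1E l x c : 0 < complex.Re l ->
  l *: extra_emb Xdm1 x - extra_op Xdm1 x = Cstar c -> x1 l c = x.
Proof.
move=> l0; apply: extra_resolventE => //.
- exact: adjoint_main_operator_linear.
- exact: adjoint_main_operator_dissipative.
- by move=> m; apply: adjoint_main_operator_onto.
Qed.

Let emb_shift (A : set (X * X)) (E : extrapolation A) l z x (b : E) :
  extra_emb E z = extra_op E x + b -> l *: x - z = 0 ->
  l *: extra_emb E x - extra_op E x = b.
Proof.
by move=> zE /subr0_eq lxz; rewrite -linearZ /= lxz zE addrC addKr.
Qed.

Let x2_eq l v : 0 < complex.Re l ->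
  l *: extra_emb Xm1 (x2 l v) - extra_op Xm1 (x2 l v) = B v.
Proof.
move=> l0; have [x [z [y [Sp xz]]]] := node_onto S_node S_conservative Xm1 0 v l0.
have xE := emb_shift (B_control.2 _ _ _ (ex_intro _ y Sp)) xz.
by rewrite (x2E l0 xE).
Qed.

Let x1_eq l c : 0 < complex.Re l ->
  l *: extra_emb Xdm1 (x1 l c) - extra_op Xdm1 (x1 l c) = Cstar c.
Proof.
move=> l0; have [x [z [u [Sp xz]]]] := adjoint_node_onto S_node S_conservative Xm1 0 c l0.
have xE := emb_shift (Cstar_control.2 _ _ _ (ex_intro _ u Sp)) xz.
by rewrite (x1E l0 xE).
Qed.

Let resolvent_lin (A : set (X * X)) (E : extrapolation A) (V : lmodType R[i])
    (b : V -> E) l (r : V -> X) a v v' :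
  (forall v x, l *: extra_emb E x - extra_op E x = b v -> r v = x) ->
  (forall v, l *: extra_emb E (r v) - extra_op E (r v) = b v) ->
  linear b -> r (a *: v + v') = a *: r v + r v'.
Proof.
move=> rE r_eq b_lin; apply: rE; rewrite b_lin -!r_eq.
rewrite (linearP (extra_emb E)) (linearP (extra_op E)) [in RHS]scalerBr scalerDr.
by rewrite !scalerA (mulrC a) opprD addrACA.
Qed.

Let x2_lin l a v v' : 0 < complex.Re l ->
  x2 l (a *: v + v') = a *: x2 l v + x2 l v'.
Proof.
move=> l0; apply: (@resolvent_lin _ Xm1 U B l) => [w x|w|].
- exact: x2E.
- exact: x2_eq.
- exact: B_control.1.1.
Qed.

Let x1_lin l a c c' : 0 < complex.Re l ->
  x1 l (a *: c + c') = a *: x1 l c + x1 l c'.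
Proof.
move=> l0; apply: (@resolvent_lin _ Xdm1 Y Cstar l) => [w x|w|].
- exact: x1E.
- exact: x1_eq.
- exact: Cstar_control.1.1.
Qed.

(** A solution in [S] of [l x - z = 0] with input [v] also solves the extrapolated equation with
    right-hand side [B v], and injectivity there identifies it with [x2 l v]. *)
Let input_spec l v : 0 < complex.Re l ->
  S ((x2 l v, v), (l *: x2 l v, phi l v)).
Proof.
move=> l0; have [x [z [y [Sp xz]]]] := node_onto S_node S_conservative Xm1 0 v l0.
have xE := emb_shift (B_control.2 _ _ _ (ex_intro _ y Sp)) xz.
rewrite (x2E l0 xE) (subr0_eq xz).
suff -> : phi l v = y by [].
rewrite /phi /transfer_function -/(x2 l v) (x2E l0 xE).
apply: xget_subset1 => [|y1 y2 [z1 /= Sp1] [z2 /= Sp2]]; first by exists z.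
by have [] := node_functional S_node Sp1 Sp2.
Qed.

(** The state is found as in [input_spec]. Pairing with the input pair at [l^*] cancels the state
    terms and identifies the last component as the adjoint of [phi l^*] at [c]. *)
Let tilde_spec l c : 0 < complex.Re l ->
  Sd ((x1 l c, c), (l *: x1 l c, tilde phi l c)).
Proof.
move=> l0; have [x [z [u [Sp xz]]]] := adjoint_node_onto S_node S_conservative Xm1 0 c l0.
have xE := emb_shift (Cstar_control.2 _ _ _ (ex_intro _ u Sp)) xz.
rewrite (x1E l0 xE) (subr0_eq xz).
suff -> : tilde phi l c = u by [].
apply: adjointE => v; have l0' : 0 < complex.Re l^* by case: (l) l0.
have := (graph_adjointP _ _ _ _ _).1 Sp _ _ _ _ (input_spec v l0').
by rewrite -(subr0_eq xz) innerZl innerZr => /addrI.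
Qed.

Let tilde_adj l c v : 0 < complex.Re l ->
  '[phi l^* v, c] = '[v, tilde phi l c].
Proof.
move=> l0; have l0' : 0 < complex.Re l^* by case: (l) l0.
have := (graph_adjointP _ _ _ _ _).1 (tilde_spec c l0) _ _ _ _ (input_spec v l0').
by rewrite innerZl innerZr => /addrI.
Qed.

Let output_spec l c : 0 < complex.Re l ->
  S ((x1 l c, tilde phi l c), (- (l *: x1 l c), c)).
Proof.
by move=> l0; apply: (adjoint_node_flip S_node S_conservative Xm1); apply: tilde_spec.
Qed.

Let x2_bound l v : 0 < complex.Re l ->
  rnorm (x2 l v) <= ((2 * complex.Re l)^-1 + 1) * rnorm v.
Proof.
move=> l0; apply: square_bound; rewrite ?rnorm_ge0 ?mulr_gt0//.
have := energy_rnorm S_energy (input_spec v l0).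
rewrite innerZl inner_rnorm; have := sqr_ge0 (rnorm (phi l v)).
by case: (l) => a b /=; rewrite mulr0 subr0; lra.
Qed.

Let x1_bound l c : 0 < complex.Re l ->
  rnorm (x1 l c) <= ((2 * complex.Re l)^-1 + 1) * rnorm c.
Proof.
move=> l0; apply: square_bound; rewrite ?rnorm_ge0 ?mulr_gt0//.
have := energy_rnorm Sd_energy (tilde_spec c l0).
rewrite innerZl inner_rnorm; have := sqr_ge0 (rnorm (tilde phi l c)).
by case: (l) => a b /=; rewrite mulr0 subr0; lra.
Qed.

Let Re_conj (l : R[i]) : complex.Re l^* = complex.Re l. Proof. by case: l. Qed.

(** The difference of the two input pairs has input 0, so [m^* - A] sends [xm - xa] to
    [(a^* - m^* ) xa], and the dissipative bound applies. *)
Let x2_lipschitz a m v : 0 < complex.Re a -> 0 < complex.Re m ->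
  complex.Re m * rnorm (x2 m^* v - x2 a^* v) <=
    cnorm (m - a) * (((2 * complex.Re a)^-1 + 1) * rnorm v).
Proof.
move=> a0 m0; have [a0' m0'] : 0 < complex.Re a^* /\ 0 < complex.Re m^*.
  by rewrite !Re_conj.
have := S_lin (-1) (input_spec v a0') (input_spec v m0').
set xm := x2 m^* v; set xa := x2 a^* v; set p := _ + _.
have -> : p = ((xm - xa, 0), (m^* *: xm - a^* *: xa, phi m^* v - phi a^* v)).
  by congr ((_, _), (_, _)); inner_ring.
move=> /(energy_rnorm S_energy); rewrite rnorm0 => en.
have /(@dissipative_lower_bound _ _ _ _ m^*) :
    complex.Re '[m^* *: xm - a^* *: xa, xm - xa] <= 0.
  by have := sqr_ge0 (rnorm (phi m^* v - phi a^* v)); lra.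
rewrite Re_conj => /le_trans; apply.
rewrite (_ : _ - _ = (a^* - m^*) *: xa); last by inner_ring.
rewrite rnormZ -rmorphB cnormJ -cnormN opprB ler_wpM2l ?cnorm_ge0//.
by rewrite -(Re_conj a); apply: x2_bound.
Qed.

Let x1_lipschitz a m c : 0 < complex.Re a -> 0 < complex.Re m ->
  complex.Re m * rnorm (x1 m^* c - x1 a^* c) <=
    cnorm (m - a) * (((2 * complex.Re a)^-1 + 1) * rnorm c).
Proof.
move=> a0 m0; have [a0' m0'] : 0 < complex.Re a^* /\ 0 < complex.Re m^*.
  by rewrite !Re_conj.
have := linear_graph_adjoint (-1) (tilde_spec c a0') (tilde_spec c m0').
set xm := x1 m^* c; set xa := x1 a^* c; set p := _ + _.
have -> : p = ((xm - xa, 0),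
    (m^* *: xm - a^* *: xa, tilde phi m^* c - tilde phi a^* c)).
  by congr ((_, _), (_, _)); inner_ring.
move=> /(energy_rnorm Sd_energy); rewrite rnorm0 => en.
have /(@dissipative_lower_bound _ _ _ _ m^*) :
    complex.Re '[m^* *: xm - a^* *: xa, xm - xa] <= 0.
  by have := sqr_ge0 (rnorm (tilde phi m^* c - tilde phi a^* c)); lra.
rewrite Re_conj => /le_trans; apply.
rewrite (_ : _ - _ = (a^* - m^*) *: xa); last by inner_ring.
rewrite rnormZ -rmorphB cnormJ -cnormN opprB ler_wpM2l ?cnorm_ge0//.
by rewrite -(Re_conj a); apply: x1_bound.
Qed.

Variable Hs : rkhs (Ks phi).
Variable E : Hs -> X.
Hypothesis E_input : bilateral_input_map B Cstar E.

Let E_lin a p q : E (a *: p + q) = a *: E p + E q.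
Proof. exact: E_input.1.1. Qed.

Let Re_cplus (l : cplus R) : 0 < complex.Re (l : R[i]).
Proof.
case: l => l /= l0; rewrite -ltcR; apply: (lt_le_trans l0).
by rewrite ReE -ReJ_add.
Qed.

Let Re_cplus_conj (l : cplus R) : 0 < complex.Re (l : R[i])^*.
Proof. by rewrite Re_conj. Qed.

Let E_gen (l ls : cplus R) c v :
  E (rk_adj Hs (l, ls) (c, v)) = x1 (l : R[i])^* c + x2 (ls : R[i])^* v.
Proof. exact: E_input.2. Qed.

Let sum_conj_neq0 (l m : cplus R) : (m : R[i]) + (l : R[i])^* != 0.
Proof.
apply/eqP => /(congr1 (@complex.Re R)); rewrite raddfD /= Re_conj.
by have := Re_cplus l; have := Re_cplus m; lra.
Qed.

(** The diagonal blocks come from the balance between two pairs of the same kind. The off-diagonal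
    ones mix an input and an output pair; their scalar factor is a difference of parameters, which
    may vanish, hence [inner_diff_quotient]. *)
Let inner_generators (l ls m ms : cplus R) c v c' v' :
  '[E (rk_adj Hs (l, ls) (c, v)), E (rk_adj Hs (m, ms) (c', v'))] =
  '[rk_adj Hs (l, ls) (c, v), rk_adj Hs (m, ms) (c', v')].
Proof.
rewrite -rk_adjP rk_adjE !E_gen.
have [l0 ls0 m0 ms0] := And4 (Re_cplus_conj l) (Re_cplus_conj ls) (Re_cplus_conj m)
  (Re_cplus_conj ms).
have e11 : '[x1 (l : R[i])^* c, x1 (m : R[i])^* c'] =
    '[((m : R[i]) + (l : R[i])^*)^-1 *: (c - phi m (adjoint (phi l) c)), c'].
  have := energy_polarized S_lin S_energy (output_spec c l0) (output_spec c' m0).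
  rewrite -tilde_adj// conjCK !innerNl !innerNr !innerZl innerZr conjCK.
  rewrite ?innerZl innerDl innerNl.
  have -> : adjoint (phi l) c = tilde phi (l : R[i])^* c by rewrite /tilde conjCK.
  move=> h; apply: (mulfI (sum_conj_neq0 l m)); rewrite mulVKf ?sum_conj_neq0//.
  by apply: oppr_inj; rewrite opprB -h; ring.
have e22 : '[x2 (ls : R[i])^* v, x2 (ms : R[i])^* v'] =
    '[((ms : R[i]) + (ls : R[i])^*)^-1 *:
        (v - tilde phi ms (adjoint (tilde phi ls) v)), v'].
  have := energy_polarized S_lin S_energy (input_spec v ls0) (input_spec v' ms0).
  have -> : adjoint (tilde phi ls) v = phi (ls : R[i])^* v.
    by apply: adjointE => y; rewrite innerC -tilde_adj// -innerC.
  rewrite [X in _ - X]innerC tilde_adj// -innerC !innerZl innerZr conjCK.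
  rewrite ?innerZl innerDl innerNl.
  move=> h; apply: (mulfI (sum_conj_neq0 ls ms)); rewrite mulVKf ?sum_conj_neq0//.
  by rewrite -h; ring.
have e21 : '[x2 (ls : R[i])^* v, x1 (m : R[i])^* c'] =
    '[diff_quotient (phi^~ v) m (ls : R[i])^*, c'].
  symmetry; apply: (@inner_diff_quotient _ _ _ _ _ (fun m c => x1 m^* c) _ _
    ((2 * complex.Re (ls : R[i])^*)^-1 + 1) ((2 * complex.Re (ls : R[i])^*)^-1 + 1)) => //.
  - by rewrite addr_ge0 ?invr_ge0 ?mulr_ge0// ltW.
  - by move=> b w w'; apply: x1_lin; rewrite Re_conj.
  - by move=> w; rewrite -[X in 2 * X]Re_conj; apply: x1_bound; rewrite Re_conj.
  - by move=> n w n0; apply: x1_lipschitz.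
  - move=> n w n0; have n0' : 0 < complex.Re n^* by rewrite Re_conj.
    have := energy_polarized S_lin S_energy (input_spec v ls0) (output_spec w n0').
    rewrite -tilde_adj// conjCK !innerNr !innerZl innerZr conjCK innerDl innerNl.
    by move=> h; apply: oppr_inj; rewrite opprB -h; ring.
have e12 : '[x1 (l : R[i])^* c, x2 (ms : R[i])^* v'] =
    '[diff_quotient ((tilde phi)^~ c) ms (l : R[i])^*, v'].
  symmetry; apply: (@inner_diff_quotient _ _ _ _ _ (fun m v => x2 m^* v) _ _
    ((2 * complex.Re (l : R[i])^*)^-1 + 1) ((2 * complex.Re (l : R[i])^*)^-1 + 1)) => //.
  - by rewrite addr_ge0 ?invr_ge0 ?mulr_ge0// ltW.
  - by move=> b w w'; apply: x2_lin; rewrite Re_conj.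
  - by move=> w; rewrite -[X in 2 * X]Re_conj; apply: x2_bound; rewrite Re_conj.
  - by move=> n w n0; apply: x2_lipschitz.
  - move=> n w n0; have n0' : 0 < complex.Re n^* by rewrite Re_conj.
    have := energy_polarized S_lin S_energy (output_spec c l0) (input_spec w n0').
    rewrite [X in _ - X]innerC tilde_adj// -innerC !innerNl !innerZl innerZr conjCK.
    by rewrite innerDl innerNl => <-; ring.
rewrite innerDl !innerDr e11 e12 e21 e22.
rewrite -[RHS]/('[_, _] + '[_, _]) /= !innerDl; ring.
Qed.

(** By the reproducing property such a [q] vanishes at every point. *)
Let generators_orth q :
  (forall t w, '[rk_adj Hs t w, q] = 0) -> q = 0.
Proof.
move=> qP; apply: (@rk_eval_inj _ _ _ _ Hs); apply: funext => t.
have -> : rk_eval (0 : Hs) t = 0.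
  have := rk_eval_linear t (-1) (0 : Hs) 0.
  by rewrite scaler0 addr0 scaleN1r addNr.
have ev w : '[rk_eval q t, w] = 0 by rewrite rk_adjP innerC qP rmorph0.
case: (rk_eval q t) ev => y u ev; congr pair; apply: inner_eq0 => z.
  have := ev (z, 0); rewrite -[LHS]/('[y, z] + '[u, 0]) inner0r addr0 innerC.
  by move=> /eqP; rewrite fmorph_eq0 => /eqP.
have := ev (0, z); rewrite -[LHS]/('[y, 0] + '[u, z]) inner0r add0r innerC.
by move=> /eqP; rewrite fmorph_eq0 => /eqP.
Qed.

Let E_riesz g : exists q, forall f, '[E f, g] = '[f, q].
Proof.
have [K K0 EK] := bounded_operator_rnorm E_input.1.
apply: riesz => [a x y|]; first by rewrite E_lin innerDl innerZl.
exists (K * rnorm g) => [|x]; first by rewrite mulr_ge0 ?rnorm_ge0.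
apply: le_trans (cauchy_schwarz _ _) _.
by rewrite mulrAC ler_wpM2r ?rnorm_ge0.
Qed.

(** The Riesz representative of [f |-> <E f, E g>] is [E^* E g]. Pairing with kernel functions shows
    that it equals [g], at first for [g] a kernel function and then, by symmetry, for every [g]. *)
Let E_inner f g : '[E f, E g] = '[f, g].
Proof.
have gen t w h : '[E h, E (rk_adj Hs t w)] = '[h, rk_adj Hs t w].
  have [q qP] := E_riesz (E (rk_adj Hs t w)); rewrite qP.
  suff -> : q = rk_adj Hs t w by [].
  apply/subr0_eq/generators_orth => -[s1 s2] [c v]; case: t w qP => [t1 t2] [c' v'] qP.
  by rewrite innerDr innerNr -qP inner_generators subrr.
have [q qP] := E_riesz (E g); rewrite qP.
suff -> : q = g by [].
apply/subr0_eq/generators_orth => t w.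
by rewrite innerDr innerNr -qP innerC gen -innerC subrr.
Qed.

Let E_isometric : isometric E.
Proof.
move=> f; rewrite !normE; congr _%:C%C.
apply: (@pexpIrn _ 2) => //; rewrite ?nnegrE ?rnorm_ge0//.
by apply: complexI; rewrite -!inner_rnorm E_inner.
Qed.

Let E_rnorm f : rnorm (E f) = rnorm f.
Proof. by rewrite /rnorm E_isometric. Qed.

Let E_B f g : E (f - g) = E f - E g.
Proof. by rewrite addrC -scaleN1r E_lin scaleN1r addrC. Qed.

Let E_model p : model Hs p -> S ((E p.1.1, p.1.2), (E p.2.1, p.2.2)).
Proof.
pose P := [set p : (Hs * U) * (Hs * Y) | S ((E p.1.1, p.1.2), (E p.2.1, p.2.2))].
have [[S0 _ _] S_closed _ _ _] := S_node.
have E0 : E 0 = 0 by rewrite -[0 in LHS](subrr 0) E_B subrr.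
have P_closed : closed P.
  apply: rnorm_closed => -[[h u] [k y]] P_adh; apply: closed_rnorm S_closed _ => e e0.
  have [|[[h' u'] [k' y']] /= Sp d] := P_adh (e / 4); first by rewrite divr_gt0.
  exists ((E h', u'), (E k', y')) => //.
  have d1 : rnorm ((h' - h, u' - u) : Hs * U) < e / 4.
    by apply: le_lt_trans d; apply: (rnorm_fst_le (((h', u'), (k', y')) - ((h, u), (k, y)))).
  have d2 : rnorm ((k' - k, y' - y) : Hs * Y) < e / 4.
    by apply: le_lt_trans d; apply: (rnorm_snd_le (((h', u'), (k', y')) - ((h, u), (k, y)))).
  have := rnorm_pair_le ((E h' - E h, u' - u) : X * U) ((E k' - E k, y' - y) : X * Y).
  have := rnorm_pair_le (E h' - E h) (u' - u).
  have := rnorm_pair_le (E k' - E k) (y' - y).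
  have := rnorm_fst_le ((h' - h, u' - u) : Hs * U).
  have := rnorm_snd_le ((h' - h, u' - u) : Hs * U).
  have := rnorm_fst_le ((k' - k, y' - y) : Hs * Y).
  have := rnorm_snd_le ((k' - k, y' - y) : Hs * Y).
  rewrite -!E_B !E_rnorm /=; move=> *.
  apply: le_lt_trans (_ : rnorm ((E (h' - h), u' - u), (E (k' - k), y' - y)) < e).
    by rewrite !E_B.
  lra.
have P_lin a p' q : P p' -> P q -> P (a *: p' + q).
  by move=> Pp Pq; rewrite /P /= !E_lin; apply: (S_lin a Pp Pq).
rewrite /model => mp; apply: P_closed; apply: closure_subset mp.
apply: lspan_min => //; first by rewrite /P /= E0.
move=> _ [l [ls [c [v ->]]]] /=; rewrite /P /= !E_gen.
(* The image of a generating pair of the model is the output pair at [l^*] plus the input pair at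
   [ls^*]. *)
have := S_lin 1 (output_spec c (Re_cplus_conj l)) (input_spec v (Re_cplus_conj ls)).
congr (S ((_, _), (_, _))) => /=; rewrite ?scale1r//.
have x1_0 : x1 (l : R[i])^* 0 = 0.
  have := x1_lin (-1) 0 0 (Re_cplus_conj l).
  by rewrite scaler0 addr0 scaleN1r addNr.
have x2_0 : x2 (ls : R[i])^* 0 = 0.
  have := x2_lin (-1) 0 0 (Re_cplus_conj ls).
  by rewrite scaler0 addr0 scaleN1r addNr.
rewrite -[_ *: c]addr0 -[_ *: v]addr0 x1_lin ?Re_cplus_conj// x2_lin ?Re_cplus_conj//.
by rewrite x1_0 x2_0 !addr0 scaleNr.
Qed.

Lemma bilateral_input_map_intertwines : intertwines (model Hs) S E /\ isometric E.
Proof.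
split; last exact: E_isometric.
split; first exact: E_input.1.
- by move=> x u [[z y] /E_model /= Sp]; exists (E z, y).
- apply/seteqP; split=> -[[x u] [z y]] /=.
    move=> [[z' y'] mp [-> ->]]; split; first by exists (z', y').
    exact: E_model mp.
  (* The model value at [(x, u)] is also sent into [S], which is single-valued. *)
  move=> [[[z' y'] mp] Sp]; exists (z', y') => //.
  exact: (node_functional S_node Sp (E_model mp)).
Qed.

Lemma simple_unitary : simple B Cstar <-> unitary E.
Proof.
rewrite /simple; set G := [set x | _].
have G_range : G `<=` range E.
  move=> _ [l [ls [c [v [l0 ls0 ->]]]]].
  have l0' : 0 < 'Re l^* by move: l0; rewrite !ReE conjCK addrC.
  have ls0' : 0 < 'Re ls^* by move: ls0; rewrite !ReE conjCK addrC.
  (* Simplicity is stated without conjugates, the input map with them; conjugation preserves the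
     half-plane. *)
  exists (rk_adj Hs (exist _ l^* l0', exist _ ls^* ls0') (c, v)) => //.
  by rewrite E_gen /= !conjCK.
split=> [G_dense|[_ E_onto]].
  split=> [|w]; first exact: E_inner.
  have /closure_rnormP w_adh : closure (range E) w.
    have : closure (lspan G) w by rewrite G_dense.
    apply: closure_subset; apply: lspan_min G_range.
      by exists 0 => //; rewrite -[0 in LHS](subrr 0) E_B subrr.
    by move=> a _ _ [f _ <-] [g _ <-]; exists (a *: f + g).
  have /choice[f fP] n : exists f, rnorm (E f - w) < n.+1%:R^-1.
    have [|_ [f _ <-] fw] := w_adh n.+1%:R^-1; first by rewrite invr_gt0.
    by exists f.
  have [|x xP] := @cauchy_rnorm _ _ f.
    move=> e e0; have [|k kP] := @invr_nat_lt R (e / 2); first by rewrite divr_gt0.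
    exists k => n m kn km; rewrite -E_rnorm E_B.
    have := rnormB (E (f n)) w (E (f m)); rewrite (rnormBC w).
    have := fP n; have := fP m; have := kP n kn; have := kP m km.
    move: n.+1%:R^-1 m.+1%:R^-1 => a b; lra.
  exists x; apply/subr0_eq/rnorm_eq0/eqP; rewrite eq_le rnorm_ge0 andbT.
  apply/ler_addgt0Pr => e e0; rewrite add0r.
  have [|n0 n0P] := xP (e / 2); first by rewrite divr_gt0.
  have [|k kP] := @invr_nat_lt R (e / 2); first by rewrite divr_gt0.
  pose n := maxn n0 k; have := n0P n (leq_maxl _ _); have := kP n (leq_maxr _ _).
  have := fP n; have := rnormB (E x) (E (f n)) w; rewrite -E_B E_rnorm (rnormBC x).
  by move: n.+1%:R^-1 => a; lra.
(* If [q = E p] is orthogonal to the spanning vectors, then [p] is orthogonal to all kernel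
   functions, because [E] preserves inner products. *)
apply: dense_lspan => q qP; have [p pE] := E_onto q.
suff -> : q = E 0 by rewrite -[0 in LHS](subrr 0) E_B subrr.
rewrite -pE; congr E; apply: generators_orth => -[l ls] [c v].
rewrite -E_inner pE; apply: qP; rewrite E_gen.
exists (l : R[i])^*, (ls : R[i])^*, c, v; split=> //.
  by case: (l) => z /=; rewrite !ReE conjCK addrC.
by case: (ls) => z /=; rewrite !ReE conjCK addrC.
Qed.

End BilateralInputMap.

Theorem theorem4p3 (R : realType) (U X Y : hilbertType R)
    (U_separable : separable U) (Y_separable : separable Y)
    (S : set ((X * U) * (X * Y)))
    (S_node : system_node S) (S_conservative : conservative S)
    (Xm1 : extrapolation (main_operator S))
    (B : U -> Xm1) (B_control : control_operator S B)
    (Xdm1 : extrapolation (graph_adjoint (main_operator S)))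
    (Cstar : Y -> Xdm1)
    (Cstar_control : control_operator (graph_adjoint S) Cstar)
    (phi : R[i] -> U -> Y) (phi_transfer : phi = transfer_function S B)
    (Hs : rkhs (Ks phi))
    (Bbil : Hs -> X) (Bbil_input : bilateral_input_map B Cstar Bbil) :
  (intertwines (model Hs) S Bbil /\ isometric Bbil) /\
  (simple B Cstar <-> unitary Bbil).
Proof.
rewrite {}phi_transfer in Hs Bbil Bbil_input *; split.
  exact: (bilateral_input_map_intertwines S_node S_conservative B_control
    Cstar_control Bbil_input).
exact: (simple_unitary S_node S_conservative B_control Cstar_control Bbil_input).
Qed.
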